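(* Let $H$ be a weak Hopf algebra in $\mathsf{C}$, let $(B,\varphi_B)$, $(B,\phi_B)$ be left weak $H$-module algebras (on the same algebra $B$) and let $\sigma,\tau:H\otimes H\to B$ be morphisms such that $\sigma\ast u_2^{\varphi_B}=\sigma$, $\tau\ast u_2^{\phi_B}=\tau$. Assume that $\sigma$ (with respect to $\varphi_B$) and $\tau$ (with respect to $\phi_B$) satisfy the twisted condition, the 2-cocycle condition and the normal condition. The following assertions are equivalent: (i) The weak crossed products $(B\otimes H,\mu_{B\otimes_{\varphi_B}^{\sigma}H})$ and $(B\otimes H,\mu_{B\otimes_{\phi_B}^{\tau}H})$ are equivalent. (ii) There exists a gauge transformation $(h,h^{-1})$ for $\varphi_B$ such that the following equalities hold: $$h\ast h^{-1}=u_1^{\phi_B},\qquad h\circ\eta_H=\eta_B,$$ $$\mu_B\circ(B\otimes h)\circ P_{\phi_B}=\mu_B\circ(h\otimes\varphi_B)\circ(\delta_H\otimes B),$$ $$\mu_B\circ(B\otimes h)\circ F_\tau=\mu_B\circ(\mu_B\otimes\sigma)\circ(B\otimes P_{\varphi_B}\otimes H)\circ\big(((h\otimes H)\circ\delta_H)\otimes((h\otimes H)\circ\delta_H)\big).$$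
   Context: Category. $\mathsf{C}$ is a strict symmetric monoidal category with tensor product $\otimes$, unit object $K$ and symmetry $c$, in which every idempotent splits (for $q:M\to M$ with $q\circ q=q$ there are an object $N$, the image, and $i:N\to M$, $p:M\to N$ with $q=i\circ p$, $p\circ i=id_N$). For an object $M$ and a morphism $f$, $M\otimes f$ and $f\otimes M$ mean $id_M\otimes f$ and $f\otimes id_M$. Algebras $(A,\eta_A,\mu_A)$ are unital and associative, coalgebras $(D,\varepsilon_D,\delta_D)$ counital and coassociative; $\delta_{D\otimes E}=(D\otimes c_{D,E}\otimes E)\circ(\delta_D\otimes\delta_E)$. For $f,g:D\to A$ the convolution is $f\ast g=\mu_A\circ(f\otimes g)\circ\delta_D$. Weak Hopf algebra. An object $H$ with algebra structure $(\eta_H,\mu_H)$ and coalgebra structure $(\varepsilon_H,\delta_H)$ such that: (a1) $\delta_H\circ\mu_H=(\mu_H\otimes\mu_H)\circ\delta_{H\otimes H}$; (a2) $\varepsilon_H\circ\mu_H\circ(\mu_H\otimes H)=((\varepsilon_H\circ\mu_H)\otimes(\varepsilon_H\circ\mu_H))\circ(H\otimes\delta_H\otimes H)=((\varepsilon_H\circ\mu_H)\otimes(\varepsilon_H\circ\mu_H))\circ(H\otimes(c_{H,H}\circ\delta_H)\otimes H)$; (a3) $(\delta_H\otimes H)\circ\delta_H\circ\eta_H=(H\otimes\mu_H\otimes H)\circ((\delta_H\circ\eta_H)\otimes(\delta_H\circ\eta_H))=(H\otimes(\mu_H\circ c_{H,H})\otimes H)\circ((\delta_H\circ\eta_H)\otimes(\delta_H\circ\eta_H))$;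 and there is an antipode $\lambda_H:H\to H$ with (a4) $id_H\ast\lambda_H=((\varepsilon_H\circ\mu_H)\otimes H)\circ(H\otimes c_{H,H})\circ((\delta_H\circ\eta_H)\otimes H)$, (a5) $\lambda_H\ast id_H=(H\otimes(\varepsilon_H\circ\mu_H))\circ(c_{H,H}\otimes H)\circ(H\otimes(\delta_H\circ\eta_H))$, (a6) $\lambda_H\ast id_H\ast\lambda_H=\lambda_H$. Actions. A measuring is a morphism $\varphi_B:H\otimes B\to B$ with (b1) $\varphi_B\circ(H\otimes\mu_B)=\mu_B\circ(\varphi_B\otimes\varphi_B)\circ(H\otimes c_{H,B}\otimes B)\circ(\delta_H\otimes B\otimes B)$. Put $u_1^{\varphi_B}=\varphi_B\circ(H\otimes\eta_B)$, $u_2^{\varphi_B}=u_1^{\varphi_B}\circ\mu_H$. $(B,\varphi_B)$ is a left weak $H$-module algebra if moreover (b2) $\varphi_B\circ(\eta_H\otimes B)=id_B$ and (b3) $u_1^{\varphi_B}\circ\mu_H=\varphi_B\circ(H\otimes u_1^{\varphi_B})$. Let $P_{\varphi_B}=(\varphi_B\otimes H)\circ(H\otimes c_{H,B})\circ(\delta_H\otimes B)$ and, for $\sigma:H\otimes H\to B$, $F_\sigma=(\sigma\otimes\mu_H)\circ\delta_{H\otimes H}$. The morphism $\nabla^{\varphi_B}_{B\otimes H}=(\mu_B\otimes H)\circ(B\otimes P_{\varphi_B})\circ(B\otimes H\otimes\eta_B)$ is idempotent. Conditions on $\sigma$ (w.r.t. $\varphi_B$). Twisted condition: $\mu_B\circ(B\otimes\sigma)\circ(P_{\varphi_B}\otimes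 H)\circ(H\otimes P_{\varphi_B})=\mu_B\circ(B\otimes\varphi_B)\circ(F_\sigma\otimes B)$. (2-)cocycle condition: $\mu_B\circ(B\otimes\sigma)\circ(P_{\varphi_B}\otimes H)\circ(H\otimes F_\sigma)=\mu_B\circ(B\otimes\sigma)\circ(F_\sigma\otimes H)$. Normal condition: $\sigma\circ(\eta_H\otimes H)=\sigma\circ(H\otimes\eta_H)=u_1^{\varphi_B}$. Gauge transformation for $\varphi_B$. A pair of morphisms $h,h^{-1}:H\to B$ with $h^{-1}\ast h=u_1^{\varphi_B}$, $h\ast h^{-1}\ast h=h$, $h^{-1}\ast h\ast h^{-1}=h^{-1}$. Weak crossed product. $\mu_{B\otimes_{\varphi_B}^{\sigma}H}=(\mu_B\otimes H)\circ(\mu_B\otimes F_\sigma)\circ(B\otimes P_{\varphi_B}\otimes H)$. Under the assumptions of the claim it is associative and, with $\nu=\nabla^{\varphi_B}_{B\otimes H}\circ(\eta_B\otimes\eta_H)$, the image $B\times_{\varphi_B}^{\sigma}H$ of $\nabla^{\varphi_B}_{B\otimes H}$ (with splitting $i^{\varphi_B}_{B\otimes H}$, $p^{\varphi_B}_{B\otimes H}$) is an algebra with product $p^{\varphi_B}_{B\otimes H}\circ\mu_{B\otimes_{\varphi_B}^{\sigma}H}\circ(i^{\varphi_B}_{B\otimes H}\otimes i^{\varphi_B}_{B\otimes H})$ and unit $p^{\varphi_B}_{B\otimes H}\circ\nu$. Equivalence. The two weak crossed products are equivalent if there is an isomorphism $B\times_{\varphi_B}^{\sigma}H\to B\times_{\phi_B}^{\tau}H$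 of algebras, left $B$-modules and right $H$-comodules, where the left $B$-action on $B\times_{\varphi_B}^{\sigma}H$ is $p^{\varphi_B}_{B\otimes H}\circ(\mu_B\otimes H)\circ(B\otimes i^{\varphi_B}_{B\otimes H})$ and the right $H$-coaction is $(p^{\varphi_B}_{B\otimes H}\otimes H)\circ(B\otimes\delta_H)\circ i^{\varphi_B}_{B\otimes H}$, and similarly for $(\phi_B,\tau)$. *)

(* Defs.v *)
Set Implicit Arguments.
Unset Strict Implicit.
Unset Printing Implicit Defensive.

Declare Scope cat_ob_scope.
Delimit Scope cat_ob_scope with ob.
Declare Scope cat_hom_scope.
Delimit Scope cat_hom_scope with hom.
Open Scope cat_hom_scope.

Record category := Category {
  ob :> Type;
  hom : ob -> ob -> Type;
  Id : forall A, hom A A;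
  comp : forall A B D, hom B D -> hom A B -> hom A D;
  comp_id_l : forall A B (f : hom A B), comp (Id B) f = f;
  comp_id_r : forall A B (f : hom A B), comp f (Id A) = f;
  comp_assoc : forall A B D E (f : hom D E) (g : hom B D) (k : hom A B),
    comp f (comp g k) = comp (comp f g) k
}.
Bind Scope cat_ob_scope with ob.
Bind Scope cat_hom_scope with hom.
Arguments hom {c} _%_ob _%_ob.
Arguments Id {c} A%_ob.
Arguments comp {c} {A B D} _ _.

Notation "A ~> B" := (hom A%ob B%ob)
  (at level 90, B at level 89, no associativity) : type_scope.

(* Equality of morphisms in a strict monoidal category compares morphisms whose
   sources (and targets) are equal objects that need not be convertible, e.g.
   (A ⊗ B) ⊗ D and A ⊗ (B ⊗ D).  It is equality in the class of all arrows. *)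
Record arrow (C : category) := Arrow { src : C; tgt : C; mor : src ~> tgt }.
Arguments Arrow {C src tgt} mor.

Notation "f ≡ g" := (Arrow f = Arrow g) (at level 70, no associativity) : type_scope.

Record strict_monoidal := StrictMonoidal {
  smcat :> category;
  ten : smcat -> smcat -> smcat;
  K : smcat;
  tenm : forall A A' B B' : smcat,
    (A ~> A') -> (B ~> B') -> (ten A B ~> ten A' B');
  ten_assoc : forall A B D : smcat, ten (ten A B) D = ten A (ten B D);
  ten_unit_l : forall A : smcat, ten K A = A;
  ten_unit_r : forall A : smcat, ten A K = A;
  tenm_id : forall A B : smcat, tenm (Id A) (Id B) = Id (ten A B);
  tenm_comp : forall (A A' A'' B B' B'' : smcat)
    (f' : A' ~> A'') (f : A ~> A') (g' : B' ~> B'') (g : B ~> B'),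
    tenm (comp f' f) (comp g' g) = comp (tenm f' g') (tenm f g);
  tenm_assoc : forall (A A' B B' D D' : smcat)
    (f : A ~> A') (g : B ~> B') (k : D ~> D'),
    tenm (tenm f g) k ≡ tenm f (tenm g k);
  tenm_unit_l : forall (A A' : smcat) (f : A ~> A'), tenm (Id K) f ≡ f;
  tenm_unit_r : forall (A A' : smcat) (f : A ~> A'), tenm f (Id K) ≡ f
}.
Arguments ten {s} _%_ob _%_ob.
Arguments K {s}.
Arguments tenm {s} {A A' B B'} _ _.

Notation "A ⊗ B" := (ten A B) (at level 40, left associativity) : cat_ob_scope.
Notation "f ⊗ g" := (tenm f g) (at level 40, left associativity) : cat_hom_scope.

(* [ObEq A B] is solved automatically from strict associativity and unitality;
   it lets [f ∘ g] be written whenever the target of [g] and the source of [f]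
   are the same object up to these laws. *)
Class ObEq (C : category) (A B : C) : Prop := ob_eq : A = B.

Ltac strict_ob :=
  unfold ObEq;
  first [ reflexivity
        | rewrite ?ten_assoc, ?ten_unit_l, ?ten_unit_r; reflexivity ].
#[export] Hint Extern 0 (ObEq _ _) => strict_ob : typeclass_instances.

Definition retype (C : category) (A A' B B' : C)
    (eA : ObEq A A') (eB : ObEq B B') (f : A ~> B) : A' ~> B' :=
  match eA in _ = X, eB in _ = Y return X ~> Y with
  | eq_refl, eq_refl => f
  end.
Arguments retype {C A A' B B' eA eB} f.

Definition scomp (C : category) (A B B' D : C) (e : ObEq B B')
    (f : B' ~> D) (g : A ~> B) : A ~> D :=
  comp f (match e in _ = X return A ~> X with eq_refl => g end).
Arguments scomp {C A B B' D e} f g.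

Notation "f ∘ g" := (scomp f g) (at level 50, left associativity) : cat_hom_scope.

(* The remaining coherence laws of a symmetry follow from these three. *)
Record strict_symmetric_monoidal := StrictSymmetricMonoidal {
  ssmcat :> strict_monoidal;
  sym : forall A B : ssmcat, A ⊗ B ~> B ⊗ A;
  sym_natural : forall (A A' B B' : ssmcat) (f : A ~> A') (g : B ~> B'),
    sym A' B' ∘ (f ⊗ g) = (g ⊗ f) ∘ sym A B;
  sym_sym : forall A B : ssmcat, sym B A ∘ sym A B = Id (A ⊗ B);
  sym_hexagon : forall A B D : ssmcat,
    sym (A ⊗ B) D ≡ (sym A D ⊗ Id B) ∘ (Id A ⊗ sym B D)
}.
Arguments sym {s} _%_ob _%_ob.

Record splitting (C : category) (M : C) (q : M ~> M) := Splitting {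
  image : C;
  inc : image ~> M;
  proj : M ~> image;
  inc_proj : q = inc ∘ proj;
  proj_inc : proj ∘ inc = Id image
}.
Arguments image {C M q} _.
Arguments inc {C M q} _.
Arguments proj {C M q} _.

Definition idempotents_split (C : category) : Prop :=
  forall (M : C) (q : M ~> M), q ∘ q = q -> inhabited (splitting q).

Class Algebra (C : strict_monoidal) (A : C) := {
  eta : K ~> A;
  mu : A ⊗ A ~> A;
  mu_unit_l : mu ∘ (eta ⊗ Id A) ≡ Id A;
  mu_unit_r : mu ∘ (Id A ⊗ eta) ≡ Id A;
  mu_assoc : mu ∘ (mu ⊗ Id A) ≡ mu ∘ (Id A ⊗ mu)
}.
Arguments eta {C} A%_ob {_}.
Arguments mu {C} A%_ob {_}.

Class Coalgebra (C : strict_monoidal) (D : C) := {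
  epsilon : D ~> K;
  delta : D ~> D ⊗ D;
  delta_counit_l : (epsilon ⊗ Id D) ∘ delta ≡ Id D;
  delta_counit_r : (Id D ⊗ epsilon) ∘ delta ≡ Id D;
  delta_coassoc : (delta ⊗ Id D) ∘ delta ≡ (Id D ⊗ delta) ∘ delta
}.
Arguments epsilon {C} D%_ob {_}.
Arguments delta {C} D%_ob {_}.

Section Definitions.
Variable C : strict_symmetric_monoidal.

Definition delta_ten (D E : C) {dD : Coalgebra D} {dE : Coalgebra E} :
    D ⊗ E ~> (D ⊗ E) ⊗ (D ⊗ E) :=
  retype ((Id D ⊗ sym D E ⊗ Id E) ∘ (delta D ⊗ delta E)).
Arguments delta_ten D%_ob E%_ob {dD dE}.

(* Convolution of morphisms D -> A with respect to the coproduct [d] of D. *)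
Definition conv (D A : C) {aA : Algebra A} (d : D ~> D ⊗ D) (f g : D ~> A) :
    D ~> A :=
  mu A ∘ (f ⊗ g) ∘ d.

Class WeakHopf (H : C) := {
  wh_algebra :: Algebra H;
  wh_coalgebra :: Coalgebra H;
  wh_a1 : delta H ∘ mu H = (mu H ⊗ mu H) ∘ delta_ten H H;
  wh_a2 : epsilon H ∘ mu H ∘ (mu H ⊗ Id H)
    ≡ ((epsilon H ∘ mu H) ⊗ (epsilon H ∘ mu H)) ∘ (Id H ⊗ delta H ⊗ Id H);
  wh_a2' : epsilon H ∘ mu H ∘ (mu H ⊗ Id H)
    ≡ ((epsilon H ∘ mu H) ⊗ (epsilon H ∘ mu H))
      ∘ (Id H ⊗ (sym H H ∘ delta H) ⊗ Id H);
  wh_a3 : (delta H ⊗ Id H) ∘ delta H ∘ eta H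
    ≡ (Id H ⊗ mu H ⊗ Id H) ∘ ((delta H ∘ eta H) ⊗ (delta H ∘ eta H));
  wh_a3' : (delta H ⊗ Id H) ∘ delta H ∘ eta H
    ≡ (Id H ⊗ (mu H ∘ sym H H) ⊗ Id H)
      ∘ ((delta H ∘ eta H) ⊗ (delta H ∘ eta H));
  antipode : H ~> H;
  wh_a4 : conv (delta H) (Id H) antipode
    ≡ ((epsilon H ∘ mu H) ⊗ Id H) ∘ (Id H ⊗ sym H H) ∘ ((delta H ∘ eta H) ⊗ Id H);
  wh_a5 : conv (delta H) antipode (Id H)
    ≡ (Id H ⊗ (epsilon H ∘ mu H)) ∘ (sym H H ⊗ Id H) ∘ (Id H ⊗ (delta H ∘ eta H));
  wh_a6 : conv (delta H) (conv (delta H) antipode (Id H)) antipode = antipode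
}.

Section Actions.
Variables (H B : C).
Context {wH : WeakHopf H} {aB : Algebra B}.

Definition u1 (phi : H ⊗ B ~> B) : H ~> B := retype (phi ∘ (Id H ⊗ eta B)).

Definition u2 (phi : H ⊗ B ~> B) : H ⊗ H ~> B := u1 phi ∘ mu H.

Definition measuring (phi : H ⊗ B ~> B) : Prop :=
  phi ∘ (Id H ⊗ mu B)
  ≡ mu B ∘ (phi ⊗ phi) ∘ (Id H ⊗ sym H B ⊗ Id B) ∘ (delta H ⊗ Id B ⊗ Id B).

Record weak_module_algebra (phi : H ⊗ B ~> B) : Prop := {
  wma_measuring : measuring phi;
  wma_unit : phi ∘ (eta H ⊗ Id B) ≡ Id B;
  wma_u1 : u1 phi ∘ mu H = phi ∘ (Id H ⊗ u1 phi)
}.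

Definition P (phi : H ⊗ B ~> B) : H ⊗ B ~> B ⊗ H :=
  (phi ⊗ Id H) ∘ (Id H ⊗ sym H B) ∘ (delta H ⊗ Id B).

Definition F (sigma : H ⊗ H ~> B) : H ⊗ H ~> B ⊗ H :=
  (sigma ⊗ mu H) ∘ delta_ten H H.

Definition nabla (phi : H ⊗ B ~> B) : B ⊗ H ~> B ⊗ H :=
  retype ((mu B ⊗ Id H) ∘ (Id B ⊗ P phi) ∘ (Id B ⊗ Id H ⊗ eta B)).

Definition twisted (phi : H ⊗ B ~> B) (sigma : H ⊗ H ~> B) : Prop :=
  mu B ∘ (Id B ⊗ sigma) ∘ (P phi ⊗ Id H) ∘ (Id H ⊗ P phi)
  ≡ mu B ∘ (Id B ⊗ phi) ∘ (F sigma ⊗ Id B).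

Definition cocycle (phi : H ⊗ B ~> B) (sigma : H ⊗ H ~> B) : Prop :=
  mu B ∘ (Id B ⊗ sigma) ∘ (P phi ⊗ Id H) ∘ (Id H ⊗ F sigma)
  ≡ mu B ∘ (Id B ⊗ sigma) ∘ (F sigma ⊗ Id H).

Definition normal (phi : H ⊗ B ~> B) (sigma : H ⊗ H ~> B) : Prop :=
  sigma ∘ (eta H ⊗ Id H) ≡ u1 phi /\ sigma ∘ (Id H ⊗ eta H) ≡ u1 phi.

Definition gauge (phi : H ⊗ B ~> B) (h hinv : H ~> B) : Prop :=
  conv (delta H) hinv h = u1 phi /\
  conv (delta H) (conv (delta H) h hinv) h = h /\
  conv (delta H) (conv (delta H) hinv h) hinv = hinv.

Definition wcp_mu (phi : H ⊗ B ~> B) (sigma : H ⊗ H ~> B) :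
    (B ⊗ H) ⊗ (B ⊗ H) ~> B ⊗ H :=
  retype ((mu B ⊗ Id H) ∘ (mu B ⊗ F sigma) ∘ (Id B ⊗ P phi ⊗ Id H)).

Definition nu (phi : H ⊗ B ~> B) : K ~> B ⊗ H :=
  retype (nabla phi ∘ (eta B ⊗ eta H)).

Section Image.
Variables (phi : H ⊗ B ~> B) (S : splitting (nabla phi)).

Definition wcp_product (sigma : H ⊗ H ~> B) : image S ⊗ image S ~> image S :=
  proj S ∘ wcp_mu phi sigma ∘ (inc S ⊗ inc S).

Definition wcp_unit : K ~> image S := proj S ∘ nu phi.

Definition wcp_action : B ⊗ image S ~> image S :=
  proj S ∘ (mu B ⊗ Id H) ∘ (Id B ⊗ inc S).

Definition wcp_coaction : image S ~> image S ⊗ H :=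
  (proj S ⊗ Id H) ∘ (Id B ⊗ delta H) ∘ inc S.

End Image.

Definition wcp_equivalent (phi phi' : H ⊗ B ~> B) (sigma tau : H ⊗ H ~> B)
    (S : splitting (nabla phi)) (T : splitting (nabla phi')) : Prop :=
  exists (w : image S ~> image T) (w' : image T ~> image S),
    (w' ∘ w = Id (image S) /\ w ∘ w' = Id (image T)) /\
    (w ∘ wcp_product S sigma = wcp_product T tau ∘ (w ⊗ w) /\
     w ∘ wcp_unit S = wcp_unit T) /\
    w ∘ wcp_action S = wcp_action T ∘ (Id B ⊗ w) /\
    (w ⊗ Id H) ∘ wcp_coaction S = wcp_coaction T ∘ w.

End Actions.
End Definitions.
Arguments delta_ten {C} D%_ob E%_ob {dD dE}.

(* Main.v *)
From HB Require Import structures.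
From mathcomp Require Import ssreflect ssrfun ssrbool eqtype ssrnat seq path.
From Stdlib Require Import ClassicalEpsilon Eqdep_dec.
Require Import Defs.

(** The proof rests on a correspondence between morphisms g : H → B and left B-linear,
    right H-colinear endomorphisms of B ⊗ H: to g belongs Θ(b ⊗ x) = b g(x₁) ⊗ x₂, and
    g is recovered as g(x) = (B ⊗ ε)Θ(1 ⊗ x).  Composition of endomorphisms becomes
    convolution of morphisms in the opposite order, and the idempotent ∇ corresponds to u₁.

    An isomorphism between the images of the two idempotents that is B-linear and
    H-colinear is therefore the same as a pair (h, h⁻¹) with h⁻¹ ∗ h and h ∗ h⁻¹ equal to
    the two morphisms u₁, and h ∗ h⁻¹ ∗ h = h, h⁻¹ ∗ h ∗ h⁻¹ = h⁻¹.  Here h belongs to the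
    isomorphism from the crossed product of (φ', τ) to that of (φ, σ).  What is left
    is to see that the other equations for h say that its Θ respects products and
    units.  In one direction, the two equations that compare φ' with φ and τ with σ,
    together with the measuring condition, turn Θ(uv) into Θ(u)Θ(v) ([Theta_mu]).
    In the other, they are multiplicativity at (1 ⊗ x) ⊗ (b ⊗ 1) and at
    (1 ⊗ x) ⊗ (1 ⊗ y), after applying B ⊗ ε ([act_of_iso], [coc_of_iso]).

    The weak axioms enter where 1 is not grouplike.  That (b ⊗ x)(1 ⊗ 1) behaves as
    expected needs [F_eta], and that Θ preserves the unit although only h(1) = 1 is
    given needs [gau_delta_one].  Both rest on the axioms for δ²(1), the former together
    with σ ∗ u₂ = σ and normality, the latter with u₁(xy) = x.u₁(y).

    The equations are verified as in Sweedler notation, that is, on string diagrams.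
    A formula in the language of symmetric monoidal categories is compiled to a graph
    of nodes joined by named wires ([compile]); the morphism that a graph denotes
    ([den]) is well defined by the coherence theorem for symmetries
    ([structural_permute]), and does not change if a subgraph is replaced by an equal
    one ([rewrite_atP]).  The tactic [diagram] then proves an equation from the list
    of the laws that are applied to it. *)

Set Implicit Arguments.
Unset Strict Implicit.
Unset Printing Implicit Defensive.

(** * Arrows with source and target as data *)

Section PartialArrows.
Variable C : strict_symmetric_monoidal.

(** Source and target are data of an arrow and not part of its type, so the laws of a
    strict monoidal category become plain equations.  A composite of arrows that do
    not fit is [None]; as [None] absorbs everything, composition stays associative
    without side conditions. *)
Definition parrow := option (arrow C).

Definition lift (A B : C) (f : A ~> B) : parrow := Some (Arrow f).

Definition pcomp (a b : parrow) : parrow :=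
  match a, b with
  | Some f, Some g =>
      match excluded_middle_informative (tgt g = src f) with
      | left e => lift (scomp (e := e) (mor f) (mor g))
      | right _ => None
      end
  | _, _ => None
  end.

Definition pten (a b : parrow) : parrow :=
  match a, b with
  | Some f, Some g => lift (mor f ⊗ mor g)
  | _, _ => None
  end.

Definition pid (A : C) : parrow := lift (Id A).
Definition psym (A B : C) : parrow := lift (sym A B).

Definition typ (a : parrow) (A B : C) : Prop := exists f : A ~> B, a = lift f.

(** Classically, equality of objects is decidable, hence has unique proofs: how the
    objects in the middle of a composite are identified cannot influence it. *)
Lemma ob_uip (A B : C) (e e' : A = B) : e = e'.
Proof.
by apply: UIP_dec => X Y; case: (excluded_middle_informative (X = Y)); [left|right].
Qed.

Lemma lift_scomp (A B B' D : C) (e : ObEq B B') (f : B' ~> D) (g : A ~> B) :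
  lift (f ∘ g) = pcomp (lift f) (lift g).
Proof.
rewrite /pcomp /=; case: excluded_middle_informative => [e'|]; last by case.
by rewrite (ob_uip e' e).
Qed.

Lemma lift_retype (A A' B B' : C) (eA : ObEq A A') (eB : ObEq B B') (f : A ~> B) :
  lift (retype f) = lift f.
Proof. by rewrite /retype; case: A' / eA; case: B' / eB. Qed.

Lemma lift_ten (A A' B B' : C) (f : A ~> A') (g : B ~> B') :
  lift (f ⊗ g) = pten (lift f) (lift g).
Proof. by []. Qed.

(** This brings equations between partial arrows back into the category. *)
Lemma lift_inj (A B : C) (f g : A ~> B) : lift f = lift g -> f = g.
Proof.
pose cast (a : parrow) : option (A ~> B) :=
  if a is Some a then
    match excluded_middle_informative (src a = A),
          excluded_middle_informative (tgt a = B) with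
    | left eA, left eB => Some (retype (eA := eA) (eB := eB) (mor a))
    | _, _ => None
    end
  else None.
have castK (k : A ~> B) : cast (lift k) = Some k.
  rewrite /cast /lift /=.
  case: excluded_middle_informative => //; case: excluded_middle_informative => //.
  move=> eA eB; rewrite (ob_uip eA erefl) (ob_uip eB erefl) /retype.
  by [].
by move=> eq_fg; have := castK f; rewrite eq_fg castK => -[].
Qed.

Lemma lift_equiv (A B A' B' : C) (f : A ~> B) (g : A' ~> B') :
  f ≡ g -> lift f = lift g.
Proof. by rewrite /lift => ->. Qed.

Lemma typ_lift (A B : C) (f : A ~> B) : typ (lift f) A B.
Proof. by exists f. Qed.

Lemma typ_id (A : C) : typ (pid A) A A.
Proof. exact: typ_lift. Qed.

Lemma typ_sym (A B : C) : typ (psym A B) (A ⊗ B) (B ⊗ A).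
Proof. exact: typ_lift. Qed.

Lemma typ_comp a b (A B D : C) : typ a B D -> typ b A B -> typ (pcomp a b) A D.
Proof. by move=> [f ->] [g ->]; exists (f ∘ g); rewrite lift_scomp. Qed.

Lemma typ_ten a b (A A' B B' : C) :
  typ a A A' -> typ b B B' -> typ (pten a b) (A ⊗ B) (A' ⊗ B').
Proof. by move=> [f ->] [g ->]; exists (f ⊗ g). Qed.

Lemma scomp_comp (A B D : C) (e : ObEq B B) (f : B ~> D) (g : A ~> B) : f ∘ g = comp f g.
Proof. by rewrite /scomp (ob_uip e erefl). Qed.

Lemma pcompA a b c : pcomp a (pcomp b c) = pcomp (pcomp a b) c.
Proof.
case: a b c => [[A' A f]|] [[B B' g]|] [[D D' k]|] //=;
  rewrite /pcomp /=; case: excluded_middle_informative => //= eBA;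
  case: excluded_middle_informative => //= eDB.
- case: excluded_middle_informative => //= eBA'.
  simpl in *; subst.
  by rewrite (ob_uip eBA' erefl) /lift /scomp comp_assoc.
- by case: excluded_middle_informative.
Qed.

Lemma pcomp1l a (A B : C) : typ a A B -> pcomp (pid B) a = a.
Proof. by case=> f ->; rewrite -lift_scomp scomp_comp comp_id_l. Qed.

Lemma pcomp1r a (A B : C) : typ a A B -> pcomp a (pid A) = a.
Proof. by case=> f ->; rewrite -lift_scomp scomp_comp comp_id_r. Qed.

Lemma ptenA a b c : pten a (pten b c) = pten (pten a b) c.
Proof.
case: a b c => [[A' A f]|] [[B B' g]|] [[D D' k]|] //=.
by rewrite /lift /= tenm_assoc.
Qed.

Lemma pten1l a : pten (pid K) a = a.
Proof. by case: a => [[A B f]|] //=; rewrite /lift /= tenm_unit_l. Qed.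

Lemma pten1r a : pten a (pid K) = a.
Proof. by case: a => [[A B f]|] //=; rewrite /lift /= tenm_unit_r. Qed.

Lemma pid_ten (A B : C) : pid (A ⊗ B) = pten (pid A) (pid B).
Proof. by rewrite /pid -lift_ten tenm_id. Qed.

Lemma pinterchange a a' b b' (A A' A'' B B' B'' : C) :
  typ a A A' -> typ a' A' A'' -> typ b B B' -> typ b' B' B'' ->
  pcomp (pten a' b') (pten a b) = pten (pcomp a' a) (pcomp b' b).
Proof.
case=> f -> [f' ->] [g ->] [g' ->].
by rewrite -!lift_ten -!lift_scomp -lift_ten !scomp_comp tenm_comp.
Qed.

Lemma psym_natural a b (A A' B B' : C) : typ a A A' -> typ b B B' ->
  pcomp (psym A' B') (pten a b) = pcomp (pten b a) (psym A B).
Proof. by case=> f -> [g ->]; rewrite -!lift_ten -!lift_scomp sym_natural. Qed.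

Lemma psymK (A B : C) : pcomp (psym B A) (psym A B) = pid (A ⊗ B).
Proof. by rewrite -lift_scomp sym_sym. Qed.

Lemma psym_hexl (A B D : C) :
  psym (A ⊗ B) D = pcomp (pten (psym A D) (pid B)) (pten (pid A) (psym B D)).
Proof. by rewrite -!lift_ten -lift_scomp; apply/lift_equiv/sym_hexagon. Qed.

Lemma typ_eq a (A A' B B' : C) : typ a A B -> A = A' -> B = B' -> typ a A' B'.
Proof. by move=> ? <- <-. Qed.

Lemma typ_comp_eq a b (A B B' D : C) :
  typ a B D -> typ b A B' -> B' = B -> typ (pcomp a b) A D.
Proof. by move=> ta tb eB; apply: typ_comp ta _; rewrite -eB. Qed.

Lemma pten_pcompl (D A A' A'' : C) a a' : typ a A A' -> typ a' A' A'' ->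
  pten (pid D) (pcomp a' a) = pcomp (pten (pid D) a') (pten (pid D) a).
Proof.
by move=> ta ta'; rewrite (pinterchange (typ_id D) (typ_id D) ta ta') (pcomp1l (typ_id D)).
Qed.

Lemma pten_pcompr (D A A' A'' : C) a a' : typ a A A' -> typ a' A' A'' ->
  pten (pcomp a' a) (pid D) = pcomp (pten a' (pid D)) (pten a (pid D)).
Proof.
by move=> ta ta'; rewrite (pinterchange ta ta' (typ_id D) (typ_id D)) (pcomp1l (typ_id D)).
Qed.

Lemma pten_split (A A' B B' : C) a b : typ a A A' -> typ b B B' ->
  pcomp (pten a (pid B')) (pten (pid A) b) = pten a b.
Proof.
move=> ta tb; rewrite (pinterchange (typ_id A) ta tb (typ_id B')).
by rewrite (pcomp1r ta) (pcomp1l tb).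
Qed.

Lemma pten_split' (A A' B B' : C) a b : typ a A A' -> typ b B B' ->
  pcomp (pten (pid A') b) (pten a (pid B)) = pten a b.
Proof.
move=> ta tb; rewrite (pinterchange ta (typ_id A') (typ_id B) tb).
by rewrite (pcomp1l ta) (pcomp1r tb).
Qed.

(** Both sides are inverse to [psym (B ⊗ D) A], by the other hexagon. *)
Lemma psym_hexr (A B D : C) :
  psym A (B ⊗ D) = pcomp (pten (pid B) (psym A D)) (pten (psym A B) (pid D)).
Proof.
set g := pcomp _ _.
have tg : typ g (A ⊗ (B ⊗ D)) ((B ⊗ D) ⊗ A).
  apply: (@typ_eq _ (A ⊗ B ⊗ D) _ (B ⊗ (D ⊗ A))); last by rewrite ten_assoc.
    apply: (@typ_comp_eq _ _ _ (B ⊗ (A ⊗ D)) (B ⊗ A ⊗ D)); last by rewrite ten_assoc.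
      by apply: typ_ten; [apply: typ_id | apply: typ_sym].
    by apply: typ_ten; [apply: typ_sym | apply: typ_id].
  by rewrite ten_assoc.
have gK : pcomp (psym (B ⊗ D) A) g = pid (A ⊗ (B ⊗ D)).
  rewrite psym_hexl /g -pcompA (pcompA (pten (pid B) _)).
  rewrite -(pten_pcompl _ (typ_sym A D) (typ_sym D A)) psymK pid_ten ptenA -!pid_ten.
  rewrite (@pcomp1l _ (A ⊗ B ⊗ D)); last first.
    by apply: typ_ten; [apply: typ_sym | apply: typ_id].
  by rewrite -(pten_pcompr _ (typ_sym A B) (typ_sym B A)) psymK -pid_ten ten_assoc.
by rewrite -[LHS](pcomp1r (typ_sym _ _)) -gK pcompA psymK (pcomp1l tg).
Qed.

(** The hexagon for K ⊗ K makes the invertible [psym K A] idempotent. *)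
Lemma psymK1l (A : C) : psym K A = pid A.
Proof.
have e : psym K A = pcomp (psym K A) (psym K A).
  by rewrite -{1}[K in psym K A](ten_unit_l K) psym_hexl pten1r pten1l.
have t : typ (psym K A) A A.
  by apply: (typ_eq (typ_sym K A)); rewrite ?ten_unit_l ?ten_unit_r.
have := psymK K A; rewrite e pcompA psymK ten_unit_l => <-.
by rewrite (pcomp1l t).
Qed.

Lemma psymK1r (A : C) : psym A K = pid A.
Proof.
have t : typ (psym A K) A A.
  by apply: (typ_eq (typ_sym A K)); rewrite ?ten_unit_l ?ten_unit_r.
by have := psymK A K; rewrite psymK1l (pcomp1l t) ten_unit_r.
Qed.

End PartialArrows.

Arguments lift : simpl never.
Arguments pid : simpl never.
Arguments psym : simpl never.
Arguments pcomp : simpl never.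
Arguments pten : simpl never.

(** * Coherence for permutations of tensor factors *)

Section Coherence.
Variables (C : strict_symmetric_monoidal) (T : eqType) (X : T -> C).

(** Ending every word in the unit object costs nothing, by strictness, and makes the
    tensor product of words their concatenation, the empty word included. *)
Definition obt (u : seq T) : C := foldr (fun t A => X t ⊗ A)%ob K u.

Notation wire := (T * nat)%type.
Definition obw (l : seq wire) : C := obt (map fst l).

Lemma obt_cat u v : obt (u ++ v) = (obt u ⊗ obt v)%ob.
Proof. by elim: u => [|t u IHu] /=; rewrite ?ten_unit_l // IHu ten_assoc. Qed.

Lemma obw_cat l k : obw (l ++ k) = (obw l ⊗ obw k)%ob.
Proof. by rewrite /obw map_cat obt_cat. Qed.

Lemma obw_cons x l : obw (x :: l) = (X x.1 ⊗ obw l)%ob.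
Proof. by []. Qed.

Lemma obw_cons2 x y l : obw [:: x, y & l] = (X x.1 ⊗ X y.1 ⊗ obw l)%ob.
Proof. by rewrite ten_assoc. Qed.

Definition pidw (l : seq wire) : parrow C := pid (obw l).
Definition psymw (x y : wire) : parrow C := psym (X x.1) (X y.1).

Lemma pidw_cat l k : pidw (l ++ k) = pten (pidw l) (pidw k).
Proof. by rewrite /pidw obw_cat pid_ten. Qed.

Lemma pidw_cons x l : pidw (x :: l) = pten (pid (X x.1)) (pidw l).
Proof. by rewrite /pidw obw_cons pid_ten. Qed.

Lemma pidw_nil : pidw [::] = pid K. Proof. by []. Qed.

Arguments pidw : simpl never.
Arguments psymw : simpl never.

Definition swap_head (x y : wire) (v : seq wire) : parrow C := pten (psymw x y) (pidw v).
Definition swap_at (u : seq wire) (x y : wire) (v : seq wire) : parrow C :=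
  pten (pidw u) (swap_head x y v).
Arguments swap_head : simpl never.
Arguments swap_at : simpl never.

(** [None] is reached only if [x] does not occur in the list. *)
Fixpoint pull (x : wire) (l : seq wire) : parrow C :=
  match l with
  | [::] => None
  | y :: k =>
      if y == x then pidw l
      else pcomp (swap_head y x (rem x k)) (pten (pid (X y.1)) (pull x k))
  end.

(** Selection sort: the factors of the target are pulled to the front one by one.
    Wires carry names because a word alone, when a factor is repeated, does not
    tell which permutation is meant. *)
Fixpoint permute (l l' : seq wire) : parrow C :=
  match l' with
  | [::] => pid K
  | x :: k => pcomp (pten (pid (X x.1)) (permute (rem x l) k)) (pull x l)
  end.

Definition wtyp (a : parrow C) (l l' : seq wire) := typ a (obw l) (obw l').

Lemma wtyp_id l : wtyp (pidw l) l l. Proof. exact: typ_id. Qed.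

Lemma wtyp_comp a b l k m : wtyp a k m -> wtyp b l k -> wtyp (pcomp a b) l m.
Proof. exact: typ_comp. Qed.

Lemma wtyp_ten a b l l' k k' :
  wtyp a l l' -> wtyp b k k' -> wtyp (pten a b) (l ++ k) (l' ++ k').
Proof. by rewrite /wtyp !obw_cat; exact: typ_ten. Qed.

Lemma wtyp_cons a x l l' :
  wtyp a l l' -> wtyp (pten (pid (X x.1)) a) (x :: l) (x :: l').
Proof. by move=> ta; apply: typ_ten ta; exact: typ_id. Qed.

Lemma wtyp_swap_head x y v : wtyp (swap_head x y v) (x :: y :: v) (y :: x :: v).
Proof. by rewrite /wtyp !obw_cons2; apply: typ_ten; [apply: typ_sym | apply: typ_id]. Qed.

Lemma wtyp_swap_at u x y v : wtyp (swap_at u x y v) (u ++ x :: y :: v) (u ++ y :: x :: v).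
Proof. by apply: wtyp_ten (wtyp_swap_head x y v); apply: wtyp_id. Qed.

Lemma wtyp_pull x l : x \in l -> wtyp (pull x l) l (x :: rem x l).
Proof.
elim: l => //= y k IHk; rewrite inE.
have [-> _|neq] := eqVneq y x; first exact: wtyp_id.
move=> /= /IHk tk.
by apply: wtyp_comp (wtyp_swap_head _ _ _) (wtyp_cons y tk).
Qed.

Lemma wtyp_permute l l' : perm_eq l l' -> wtyp (permute l l') l l'.
Proof.
elim: l' l => [|x k IHk] l.
  by move/perm_nilP=> ->; apply: typ_id.
move=> pl; have xl : x \in l by rewrite (perm_mem pl) mem_head.
apply: wtyp_comp (wtyp_pull xl); apply: wtyp_cons; apply: IHk.
by rewrite -(perm_cons x) (perm_trans _ pl) // perm_sym perm_to_rem.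
Qed.

Lemma swap_at_cons z u x y v : swap_at (z :: u) x y v = pten (pid (X z.1)) (swap_at u x y v).
Proof. by rewrite /swap_at pidw_cons -ptenA. Qed.

Lemma swap_head_natural a x y l l' : wtyp a l l' ->
  pcomp (pten (pid (X y.1)) (pten (pid (X x.1)) a)) (swap_head x y l)
  = pcomp (swap_head x y l') (pten (pid (X x.1)) (pten (pid (X y.1)) a)).
Proof.
move=> ta; rewrite /swap_head !ptenA -!pid_ten.
by rewrite (pten_split' (typ_sym _ _) ta) (pten_split (typ_sym _ _) ta).
Qed.

Lemma swap_headK x y v : pcomp (swap_head y x v) (swap_head x y v) = pidw (x :: y :: v).
Proof.
rewrite /swap_head -(pten_pcompr _ (typ_sym _ _) (typ_sym _ _)) psymK.
by rewrite /pidw obw_cons2 -pid_ten.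
Qed.

(** The Yang-Baxter equation is naturality of the symmetry with respect to the
    symmetry itself, both composites being read as hexagons. *)
Lemma swap_head_braid x y z r :
  pcomp (swap_head y z (x :: r))
    (pcomp (pten (pid (X y.1)) (swap_head x z r)) (swap_head x y (z :: r)))
  = pcomp (pten (pid (X z.1)) (swap_head x y r))
      (pcomp (swap_head x z (y :: r)) (pten (pid (X x.1)) (swap_head y z r))).
Proof.
have thex1 (A B D : C) : typ (pten (pid A) (psym B D)) (A ⊗ B ⊗ D) (A ⊗ D ⊗ B).
  rewrite !ten_assoc; apply: typ_ten; [exact: typ_id | exact: typ_sym].
have thex2 (A B D : C) : typ (pten (psym A D) (pid B)) (A ⊗ D ⊗ B) (D ⊗ A ⊗ B).
  by apply: typ_ten; [exact: typ_sym | exact: typ_id].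
have hex a b : pcomp (swap_head a z (b :: r)) (pten (pid (X a.1)) (swap_head b z r))
    = pten (psym (X a.1 ⊗ X b.1) (X z.1)) (pidw r).
  by rewrite psym_hexl (pten_pcompr _ (thex1 _ _ _) (thex2 _ _ _)) /swap_head pidw_cons !ptenA.
rewrite hex pcompA hex /swap_head pidw_cons !ptenA.
have tz : typ (pten (psymw x y) (pid (X z.1))) (X x.1 ⊗ X y.1 ⊗ X z.1) (X y.1 ⊗ X x.1 ⊗ X z.1).
  exact: thex2.
rewrite -(pten_pcompr _ tz (typ_sym _ _)) (psym_natural (typ_sym _ _) (typ_id _)).
by rewrite (pten_pcompr _ (typ_sym _ _) (typ_ten (typ_id _) (typ_sym _ _))).
Qed.

Lemma pidw_comp a l k : wtyp a l k -> pcomp (pidw k) a = a.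
Proof. exact: pcomp1l. Qed.

Lemma comp_pidw a l k : wtyp a l k -> pcomp a (pidw l) = a.
Proof. exact: pcomp1r. Qed.

Lemma cons_comp (x : wire) a b l k m : wtyp b l k -> wtyp a k m ->
  pten (pid (X x.1)) (pcomp a b) = pcomp (pten (pid (X x.1)) a) (pten (pid (X x.1)) b).
Proof. by move=> tb ta; rewrite (pten_pcompl _ tb ta). Qed.

(** Exchanging two neighbours before pulling [z] to the front makes no difference if
    [z] is one of them, and otherwise amounts to exchanging them afterwards. *)
Lemma pull_swap_at z u x y v : uniq (u ++ x :: y :: v) -> z \in u ++ x :: y :: v ->
  let L := u ++ x :: y :: v in let L' := u ++ y :: x :: v in
  (rem z L' = rem z L /\ pcomp (pull z L') (swap_at u x y v) = pull z L) \/
  exists u' v', [/\ rem z L = u' ++ x :: y :: v', rem z L' = u' ++ y :: x :: v' &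
    pcomp (pull z L') (swap_at u x y v)
    = pcomp (pten (pid (X z.1)) (swap_at u' x y v')) (pull z L)].
Proof.
have pull_t l : z \in l -> wtyp (pull z l) l (z :: rem z l) by exact: wtyp_pull.
elim: u => [|a u IHu] /=.
  rewrite !inE negb_or -!andbA => /and4P [nxy nxv nyv _].
  rewrite /swap_at pidw_nil pten1l.
  have [eyx|nyx] := eqVneq y x; first by rewrite eyx eqxx in nxy.
  (* [z] is one of the exchanged wires, or stands behind them. *)
  have [<-|nxz] := eqVneq x z => /=.
    move=> _; left; rewrite (negPf nyx); split=> //.
    by rewrite -pidw_cons (comp_pidw (wtyp_swap_head _ _ _)) swap_headK.
  have [<-|nyz] := eqVneq y z => /=.
    move=> _; left; split=> //.
    by rewrite -pidw_cons (comp_pidw (wtyp_swap_head _ _ _)) (pidw_comp (wtyp_swap_head _ _ _)).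
  move=> zv; right; exists [::], (rem z v); split=> //.
  rewrite pidw_nil pten1l.
  rewrite (cons_comp y (wtyp_cons x (pull_t _ zv)) (wtyp_swap_head _ _ _)).
  rewrite (cons_comp x (wtyp_cons y (pull_t _ zv)) (wtyp_swap_head _ _ _)).
  rewrite -!pcompA (swap_head_natural _ _ (pull_t _ zv)).
  rewrite [pcomp (pten (pid (X y.1)) (swap_head x z _)) _]pcompA.
  by rewrite 2!pcompA -(pcompA (swap_head y z _)) swap_head_braid !pcompA.
case/andP => au uu; rewrite in_cons => zl.
(* [z] is the first wire, or the exchange and the pulling both happen behind [a]. *)
have [eaz|naz] := eqVneq a z.
  right; exists u, v; split=> //; rewrite -eaz.
  rewrite (pidw_comp (wtyp_swap_at (a :: u) x y v)) swap_at_cons.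
  by rewrite (comp_pidw (wtyp_cons a (wtyp_swap_at u x y v))).
have {}zl : z \in u ++ [:: x, y & v] by case/predU1P: zl naz => [->|//]; rewrite eqxx.
have zl' : z \in u ++ [:: y, x & v].
  by move: zl; rewrite !mem_cat !inE !orbA [X in X || _]orbAC.
have pullsw : pcomp (pcomp (swap_head a z (rem z (u ++ [:: y, x & v])))
     (pten (pid (X a.1)) (pull z (u ++ [:: y, x & v])))) (swap_at (a :: u) x y v)
   = pcomp (swap_head a z (rem z (u ++ [:: y, x & v])))
      (pten (pid (X a.1)) (pcomp (pull z (u ++ [:: y, x & v])) (swap_at u x y v))).
  by rewrite swap_at_cons -pcompA (cons_comp a (wtyp_swap_at u x y v) (pull_t _ zl')).
case: (IHu uu zl) => [[eR e]|[u' [v' [e1 e2 e]]]].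
  by left; rewrite pullsw e eR.
right; exists (a :: u'), v'; rewrite pullsw e e1 e2; split=> //.
have mt := pull_t _ zl; rewrite e1 in mt.
rewrite (cons_comp a mt (wtyp_cons z (wtyp_swap_at u' x y v'))) !pcompA; congr (pcomp _ _).
by rewrite -(swap_head_natural _ _ (wtyp_swap_at u' x y v')) swap_at_cons.
Qed.

Lemma uniq_swap_at (u v : seq wire) x y : uniq (u ++ x :: y :: v) -> uniq (u ++ y :: x :: v).
Proof.
by rewrite (perm_uniq (_ : perm_eq (u ++ y :: x :: v) (u ++ x :: y :: v))) //
   perm_cat2l (perm_catCA [:: y] [:: x]).
Qed.

Lemma permute_swap_at u x y v l' : uniq (u ++ x :: y :: v) -> perm_eq (u ++ x :: y :: v) l' ->
  pcomp (permute (u ++ y :: x :: v) l') (swap_at u x y v) = permute (u ++ x :: y :: v) l'.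
Proof.
elim: l' u v => [|z l' IHl] u v uL pL; first by have := perm_size pL; rewrite size_cat addnS.
have zL : z \in u ++ x :: y :: v by rewrite (perm_mem pL) mem_head.
have pL' : perm_eq (u ++ y :: x :: v) (z :: l').
  by apply: perm_trans pL; rewrite perm_cat2l (perm_catCA [:: y] [:: x]).
have pr : perm_eq (rem z (u ++ x :: y :: v)) l'.
  by rewrite -(perm_cons z) (perm_trans _ pL) // perm_sym perm_to_rem.
have pr' : perm_eq (rem z (u ++ y :: x :: v)) l'.
  by rewrite -(perm_cons z) (perm_trans _ pL') // perm_sym perm_to_rem // (perm_mem pL') mem_head.
rewrite /= -pcompA.
case: (pull_swap_at uL zL) => [[-> ->] //|[u' [v' [e1 e2 ->]]]].
rewrite pcompA; congr (pcomp _ _).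
move: (rem_uniq z uL) pr pr'; rewrite e1 e2 => uL' pr pr'.
by rewrite -(cons_comp z (wtyp_swap_at u' x y v') (wtyp_permute pr')) IHl.
Qed.

Inductive structural : seq wire -> seq wire -> parrow C -> Prop :=
| structural_id l : structural l l (pidw l)
| structural_swap_at u x y v a l' : structural (u ++ y :: x :: v) l' a ->
    structural (u ++ x :: y :: v) l' (pcomp a (swap_at u x y v)).

Lemma permute_id l : permute l l = pidw l.
Proof.
by elim: l => [|x l IHl] //=; rewrite eqxx IHl -pidw_cons (pidw_comp (wtyp_id _)).
Qed.

Lemma structural_perm l l' a : structural l l' a -> perm_eq l l'.
Proof.
elim=> // u x y v _ k _ pk; apply: perm_trans pk.
by rewrite perm_cat2l (perm_catCA [:: x] [:: y]).
Qed.

(** Coherence: as [permute] absorbs exchanges of neighbours ([permute_swap_at]), a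
    structural morphism depends on its source and target only. *)
Lemma structural_permute l l' a : uniq l -> structural l l' a -> a = permute l l'.
Proof.
move=> ul sa; elim: sa ul => [k|u x y v b k sb IHb] ul; first by rewrite permute_id.
rewrite (IHb (uniq_swap_at ul)) permute_swap_at //.
by apply: structural_perm (structural_swap_at sb).
Qed.

Lemma structural_typ l l' a : structural l l' a -> wtyp a l l'.
Proof.
by elim=> [k|u x y v b k _ tb]; [apply: wtyp_id|apply: wtyp_comp tb (wtyp_swap_at _ _ _ _)].
Qed.

Lemma structural_comp l k m a b :
  structural l k a -> structural k m b -> structural l m (pcomp b a).
Proof.
move=> sa; elim: sa b => [p|u x y v c p _ IHc] b sb.
  by rewrite (comp_pidw (structural_typ sb)).
by rewrite pcompA; apply: structural_swap_at; apply: IHc.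
Qed.

Lemma structural_catr k l l' a :
  structural l l' a -> structural (l ++ k) (l' ++ k) (pten a (pidw k)).
Proof.
elim=> [p|u x y v b p sb IHb]; first by rewrite -pidw_cat; apply: structural_id.
rewrite (pten_pcompr _ (wtyp_swap_at _ _ _ _) (structural_typ sb)).
have -> : pten (swap_at u x y v) (pidw k) = swap_at u x y (v ++ k).
  by rewrite /swap_at /swap_head pidw_cat !ptenA.
by rewrite -!catA /= in IHb *; apply: structural_swap_at.
Qed.

Lemma structural_catl k l l' a :
  structural l l' a -> structural (k ++ l) (k ++ l') (pten (pidw k) a).
Proof.
elim=> [p|u x y v b p sb IHb]; first by rewrite -pidw_cat; apply: structural_id.
rewrite (pten_pcompl _ (wtyp_swap_at _ _ _ _) (structural_typ sb)).
have -> : pten (pidw k) (swap_at u x y v) = swap_at (k ++ u) x y v.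
  by rewrite /swap_at /swap_head pidw_cat !ptenA.
by rewrite !catA in IHb *; apply: structural_swap_at.
Qed.

Lemma structural_cons x l l' a :
  structural l l' a -> structural (x :: l) (x :: l') (pten (pid (X x.1)) a).
Proof. by move/(structural_catl [:: x]); rewrite /pidw /obw /= ten_unit_r. Qed.

Lemma structural_swap_head x y v : structural (x :: y :: v) (y :: x :: v) (swap_head x y v).
Proof.
have := structural_swap_at (structural_id [:: y, x & v] : structural ([::] ++ _) _ _).
by rewrite /swap_at pidw_nil pten1l (pidw_comp (wtyp_swap_head _ _ _)).
Qed.

Lemma structural_pull x l : x \in l -> structural l (x :: rem x l) (pull x l).
Proof.
elim: l => //= y k IHk; rewrite inE.
have [-> _|neq] := eqVneq y x; first exact: structural_id.
move=> /= /IHk sk.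
exact: structural_comp (structural_cons y sk) (structural_swap_head _ _ _).
Qed.

(** The hexagons split the symmetry of two words into exchanges of neighbours. *)
Lemma structural_sym l k : structural (l ++ k) (k ++ l) (psym (obw l) (obw k)).
Proof.
have sym1 x m : structural (x :: m) (m ++ [:: x]) (psym (X x.1) (obw m)).
  elim: m => [|y m IHm]; first by rewrite psymK1r /obw /= -[X _]ten_unit_r; apply: structural_id.
  rewrite obw_cons psym_hexr.
  rewrite -[psym (X x.1) (X y.1)]/(psymw x y) -/(pidw m) -/(swap_head x y m).
  apply: structural_comp (structural_swap_head x y m) _.
  exact: structural_cons.
elim: l => [|x l IHl]; first by rewrite psymK1l cats0; apply: structural_id.
rewrite obw_cons psym_hexl.
apply: structural_comp (structural_cons x IHl) _.
rewrite -[x :: l]/([:: x] ++ l) -cat1s !catA.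
by have := structural_catr l (sym1 x k); rewrite -catA.
Qed.

Lemma perm_rem x (l l' : seq wire) : perm_eq l (x :: l') -> perm_eq (rem x l) l'.
Proof.
move=> pl; have xl : x \in l by rewrite (perm_mem pl) mem_head.
by rewrite -(perm_cons x) (perm_trans _ pl) // perm_sym perm_to_rem.
Qed.

Lemma permute_structural l l' : perm_eq l l' -> structural l l' (permute l l').
Proof.
elim: l' l => [|x l' IHl] l pl.
  by move/perm_nilP: pl => ->; apply: structural_id.
apply: structural_comp (structural_pull _) (structural_cons x (IHl _ (perm_rem pl))).
by rewrite (perm_mem pl) mem_head.
Qed.

Lemma permute_comp l k m : uniq l -> perm_eq l k -> perm_eq k m ->
  pcomp (permute k m) (permute l k) = permute l m.
Proof.
move=> ul plk pkm; apply: structural_permute => //.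
by apply: structural_comp; apply: permute_structural.
Qed.

Lemma permute_catr l l' k : uniq (l ++ k) -> perm_eq l l' ->
  permute (l ++ k) (l' ++ k) = pten (permute l l') (pidw k).
Proof.
by move=> ul pl; apply/esym/structural_permute/structural_catr/permute_structural.
Qed.

Lemma permute_catl l l' k : uniq (k ++ l) -> perm_eq l l' ->
  permute (k ++ l) (k ++ l') = pten (pidw k) (permute l l').
Proof.
by move=> ul pl; apply/esym/structural_permute/structural_catl/permute_structural.
Qed.

Lemma permute_sym l k : uniq (l ++ k) -> permute (l ++ k) (k ++ l) = psym (obw l) (obw k).
Proof. by move=> ul; apply/esym/structural_permute/structural_sym. Qed.

End Coherence.

(** * String diagrams as programs on named wires *)

Section Diagrams.
Variables (C : strict_symmetric_monoidal) (T : eqType) (X : T -> C).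
Variables (G : eqType) (gdom gcod : G -> seq T) (sem : G -> parrow C).
Hypothesis sem_typ : forall g, typ (sem g) (obt X (gdom g)) (obt X (gcod g)).

Notation wire := (T * nat)%type.
(** A node of a string diagram: its generator, its input wires, its output wires. *)
Definition instr : Type := G * seq wire * seq wire.
Definition iins (i : instr) := i.1.2.
Definition iouts (i : instr) := i.2.
Definition prog := seq instr.

Definition minus (l s : seq wire) := [seq x <- l | x \notin s].

(** A node consumes its inputs and puts its outputs in front of the idle wires. *)
Definition after (l : seq wire) (i : instr) := iouts i ++ minus l (iins i).

(** The morphism drawn by the diagram with input wires [l], nodes [p] and output wires
    [l'].  Before each node the wires are permuted to bring its inputs to the front;
    by coherence, other permutations with this effect would give the same morphism. *)
Fixpoint den (l : seq wire) (p : prog) (l' : seq wire) : parrow C :=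
  match p with
  | [::] => permute X l l'
  | i :: q =>
      pcomp (den (after l i) q l')
        (pcomp (pten (sem i.1.1) (pidw X (minus l (iins i))))
           (permute X l (iins i ++ minus l (iins i))))
  end.

Definition instr_ok (l : seq wire) (i : instr) :=
  [&& uniq (iins i), all (mem l) (iins i), map fst (iins i) == gdom i.1.1
    & map fst (iouts i) == gcod i.1.1].

(** The nodes come in an order in which each finds its inputs when its turn comes. *)
Fixpoint sched (l : seq wire) (p : prog) (l' : seq wire) : bool :=
  match p with
  | [::] => perm_eq l l'
  | i :: q => instr_ok l i && sched (after l i) q l'
  end.

Definition names (l : seq wire) (p : prog) := l ++ flatten (map iouts p).

Lemma perm_minus l s : uniq l -> uniq s -> all (mem l) s -> perm_eq l (s ++ minus l s).
Proof.
move=> ul us /allP sl; apply: uniq_perm => //.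
  rewrite cat_uniq us filter_uniq // andbT.
  by apply/hasPn=> x; rewrite mem_filter => /andP[].
move=> x; rewrite mem_cat mem_filter.
by case: (boolP (x \in s)) => //= /sl.
Qed.

(** Single assignment: no name is produced twice, so a name denotes one edge of the
    diagram throughout. *)
Definition ssa (l : seq wire) (p : prog) := uniq (names l p).

Lemma ssa_l l p : ssa l p -> uniq l.
Proof. by rewrite /ssa cat_uniq => /and3P[]. Qed.

Lemma ssa_after l i p : ssa l (i :: p) -> ssa (after l i) p.
Proof.
rewrite /ssa /names /after /= => u.
rewrite -catA uniq_catCA; apply: subseq_uniq u.
by rewrite cat_subseq // filter_subseq.
Qed.

Lemma ssa_perm l k p q : perm_eq l k -> perm_eq p q -> ssa l p -> ssa k q.
Proof.
move=> pl pp; rewrite /ssa (perm_uniq (_ : perm_eq _ (names k q))) //.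
by apply: perm_cat; rewrite // perm_flatten // perm_map.
Qed.

Lemma instr_ok_perm l k i : perm_eq l k -> instr_ok l i -> instr_ok k i.
Proof.
move=> pl /and4P [us sl ed ec]; apply/and4P; split=> //.
by apply/allP => x /(allP sl); rewrite /= (perm_mem pl).
Qed.

Lemma perm_after l k i : perm_eq l k -> perm_eq (after l i) (after k i).
Proof. by move=> pl; rewrite perm_cat2l perm_filter. Qed.

Lemma sched_perml l k p l' : perm_eq k l -> sched l p l' -> sched k p l'.
Proof.
elim: p l k => [|i p IHp] l k pkl /=; first exact: perm_trans.
case/andP=> ok sp; rewrite (instr_ok_perm _ ok) 1?perm_sym //=.
by apply: IHp sp; apply: perm_after.
Qed.

Lemma sched_permr l p l' m : perm_eq l' m -> sched l p l' -> sched l p m.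
Proof.
elim: p l => [|i p IHp] l pm /=; first by move=> pl; apply: perm_trans pm.
by case/andP=> -> /= sp; apply: IHp.
Qed.

Lemma wtyp_sem l i r : instr_ok l i ->
  wtyp X (pten (sem i.1.1) (pidw X r)) (iins i ++ r) (iouts i ++ r).
Proof.
case/and4P=> _ _ /eqP ed /eqP ec; apply: wtyp_ten (wtyp_id _ _).
by rewrite /wtyp /obw ed ec; apply: sem_typ.
Qed.

Lemma wtyp_step l i : uniq l -> instr_ok l i ->
  wtyp X (pcomp (pten (sem i.1.1) (pidw X (minus l (iins i))))
            (permute X l (iins i ++ minus l (iins i))))
    l (after l i).
Proof.
move=> ul ok; apply: wtyp_comp (wtyp_sem _ ok) (wtyp_permute _ _).
by case/and4P: ok => us sl _ _; apply: perm_minus.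
Qed.

Lemma wtyp_den l p l' : ssa l p -> sched l p l' -> wtyp X (den l p l') l l'.
Proof.
elim: p l => [|i p IHp] l u /=; first exact: wtyp_permute.
case/andP=> ok sp; apply: wtyp_comp (IHp _ (ssa_after u) sp) (wtyp_step _ ok).
exact: ssa_l u.
Qed.

Lemma den_perml l k p l' : ssa l p -> perm_eq k l -> sched l p l' ->
  pcomp (den l p l') (permute X k l) = den k p l'.
Proof.
elim: p l k => [|i p IHp] l k u pkl /=.
  by apply: permute_comp => //; rewrite (perm_uniq pkl) (ssa_l u).
case/andP=> ok sp; have ul := ssa_l u; have uk : uniq k by rewrite (perm_uniq pkl).
have /and4P[us sl _ _] := ok.
have pdif : perm_eq (minus k (iins i)) (minus l (iins i)) by rewrite perm_filter.
have pl := perm_minus ul us sl.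
have pk : perm_eq k (iins i ++ minus k (iins i)).
  have /and4P[_ slk _ _] : instr_ok k i by apply: instr_ok_perm ok; rewrite perm_sym.
  exact: perm_minus.
rewrite -!pcompA permute_comp //.
have ui := uk; rewrite (perm_uniq pk) in ui.
rewrite -(IHp _ (after k i) (ssa_after u)) ?perm_after // -!pcompA; congr (pcomp _ _).
have ua : uniq (after k i) by rewrite (perm_uniq (perm_after i pkl)) (ssa_l (ssa_after u)).
rewrite permute_catl // pcompA; have /and4P[_ _ /eqP ed /eqP ec] := ok.
have semt : wtyp X (sem i.1.1) (iins i) (iouts i) by rewrite /wtyp /obw ed ec.
rewrite (pten_split' semt (wtyp_permute X pdif)) -(pten_split semt (wtyp_permute X pdif)).
by rewrite -pcompA -permute_catl // permute_comp // perm_cat2l.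
Qed.

Lemma den_permr l p l' m : ssa l p -> perm_eq l' m -> sched l p l' ->
  pcomp (permute X l' m) (den l p l') = den l p m.
Proof.
elim: p l => [|i p IHp] l u pm /=; first by move=> pl; apply: permute_comp (ssa_l u) pl pm.
by case/andP=> ok sp; rewrite pcompA IHp // ssa_after.
Qed.

Lemma ssa_catl l p q : ssa l (p ++ q) -> ssa l p.
Proof. by rewrite /ssa /names map_cat flatten_cat catA cat_uniq => /and3P[]. Qed.

Lemma sched_cat l p m q l' : sched l p m -> sched m q l' -> sched l (p ++ q) l'.
Proof.
elim: p l => [|i p IHp] l /=; first by move=> plm; apply: sched_perml.
by case/andP=> -> /= sp sq; apply: IHp.
Qed.

Lemma ssa_end l p m q : ssa l (p ++ q) -> sched l p m -> ssa m q.
Proof.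
elim: p l => [|i p IHp] l u /=; first by move=> pl; apply: ssa_perm pl (perm_refl q) u.
by case/andP=> _; apply: IHp (ssa_after u).
Qed.

Lemma den_cat l p m q l' : ssa l (p ++ q) -> sched l p m -> sched m q l' ->
  den l (p ++ q) l' = pcomp (den m q l') (den l p m).
Proof.
move=> u sp sq; elim: p l u sp => [|i p IHp] l u /=.
  by move=> plm; rewrite den_perml //; apply: ssa_perm plm (perm_refl _) u.
by case/andP=> ok sp; rewrite (IHp _ (ssa_after u) sp) -pcompA.
Qed.

Lemma minus_catl l k s : uniq (l ++ k) -> all (mem l) s -> minus (l ++ k) s = minus l s ++ k.
Proof.
move=> u sl; rewrite /minus filter_cat; congr (_ ++ _); apply/all_filterP/allP=> x xk.
apply/negP => /(allP sl) /= xl; move: u; rewrite cat_uniq => /and3P[_ /hasPn /(_ x xk)].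
by rewrite /= xl.
Qed.

Lemma instr_ok_catl l k i : instr_ok l i -> instr_ok (l ++ k) i.
Proof.
case/and4P=> us /allP sl ed ec; apply/and4P; split=> //.
by apply/allP=> x /sl /=; rewrite mem_cat => ->.
Qed.

Lemma after_catl l k i : uniq (l ++ k) -> instr_ok l i -> after (l ++ k) i = after l i ++ k.
Proof. by move=> u /and4P[_ sl _ _]; rewrite /after minus_catl // catA. Qed.

Lemma sched_catr l k p l' : ssa (l ++ k) p -> sched l p l' -> sched (l ++ k) p (l' ++ k).
Proof.
elim: p l => [|i p IHp] l u /=; first by rewrite perm_cat2r.
case/andP=> ok sp; rewrite instr_ok_catl //=; have := ssa_after u.
by rewrite after_catl ?(ssa_l u) // => u'; apply: IHp.
Qed.

(** Wires that no node touches split off as a tensor factor. *)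
Lemma den_catr l k p l' : ssa (l ++ k) p -> sched l p l' ->
  den (l ++ k) p (l' ++ k) = pten (den l p l') (pidw X k).
Proof.
elim: p l => [|i p IHp] l u /=; first by move=> pl; rewrite permute_catr // (ssa_l u).
case/andP=> ok sp; have ulk := ssa_l u.
have ul : uniq l by move: ulk; rewrite cat_uniq => /and3P[].
have /and4P[us sl _ _] := ok.
have pd := perm_minus ul us sl.
have u' := ssa_after u; rewrite after_catl // in u'.
have up : ssa (after l i) p.
  move: u'; rewrite /ssa /names; apply: subseq_uniq; rewrite cat_subseq //.
  exact: prefix_subseq.
rewrite after_catl // IHp // minus_catl // (pten_pcompr _ (wtyp_step ul ok) (wtyp_den up sp)).
congr (pcomp _ _); rewrite (pten_pcompr _ (wtyp_permute X pd) (wtyp_sem _ ok)).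
by rewrite pidw_cat ptenA -permute_catr // -catA.
Qed.

Lemma sched_catl l k p l' : ssa (k ++ l) p -> sched l p l' -> sched (k ++ l) p (k ++ l').
Proof.
move=> u sp; have pkl : perm_eq (k ++ l) (l ++ k) by rewrite perm_catC.
apply: (sched_perml pkl); apply: (@sched_permr _ _ (l' ++ k)).
  by rewrite perm_catC.
by apply: sched_catr => //; apply: ssa_perm pkl _ u.
Qed.

Lemma ssa_subl l k p : ssa (l ++ k) p -> ssa l p.
Proof.
rewrite /ssa /names; apply: subseq_uniq; rewrite cat_subseq //.
exact: prefix_subseq.
Qed.

(** The symmetry conjugates this case into [den_catr]. *)
Lemma den_catl l k p l' : ssa (k ++ l) p -> sched l p l' ->
  den (k ++ l) p (k ++ l') = pten (pidw X k) (den l p l').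
Proof.
move=> u sp; have pkl : perm_eq (k ++ l) (l ++ k) by rewrite perm_catC.
have pkl' : perm_eq (l' ++ k) (k ++ l') by rewrite perm_catC.
have u' : ssa (l ++ k) p by apply: ssa_perm pkl _ u.
have s' := sched_catr u' sp.
have ul := ssa_subl u'.
have uend : uniq (l' ++ k).
  by apply: ssa_l (ssa_end (q := [::]) _ s'); rewrite cats0.
rewrite -(den_permr u pkl' (sched_perml pkl s')) -(den_perml u' pkl s').
rewrite den_catr // permute_sym // permute_sym ?(ssa_l u) //.
have td := wtyp_den ul sp.
rewrite -(psym_natural (wtyp_id X k) td) pcompA psymK.
rewrite -obw_cat -/(pidw X _) (pidw_comp (_ : wtyp X _ (k ++ l) _)) //.
exact: wtyp_ten (wtyp_id _ _) td.
Qed.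

Lemma minus_all l s : all (mem s) l -> minus l s = [::].
Proof.
by move=> /allP ls; apply/nilP; rewrite /nilp size_filter -leqn0 leqNgt -has_count;
   apply/hasPn=> x /ls /= ->.
Qed.

Lemma instr_ok_ins l i : instr_ok l i -> instr_ok (iins i) i.
Proof. by case/and4P=> us _ ed ec; apply/and4P; split=> //; apply/allP. Qed.

Lemma sched1 l i : instr_ok l i -> sched (iins i) [:: i] (iouts i).
Proof.
move=> /instr_ok_ins ok /=; rewrite ok /= /after minus_all ?cats0 ?perm_refl //.
Qed.

Lemma den1 l i : ssa (iins i) [:: i] -> instr_ok l i -> den (iins i) [:: i] (iouts i) = sem i.1.1.
Proof.
move=> u /instr_ok_ins ok /=; rewrite /after minus_all; last exact/allP.
rewrite !cats0 pidw_nil pten1r !permute_id.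
have /and4P[_ _ /eqP ed /eqP ec] := ok.
have semt : wtyp X (sem i.1.1) (iins i) (iouts i) by rewrite /wtyp /obw ed ec.
by rewrite (comp_pidw semt) (pidw_comp semt).
Qed.

Lemma ssa_subr k l p : ssa (k ++ l) p -> ssa l p.
Proof.
by move=> u; apply: (@ssa_subl l k); apply: ssa_perm (perm_refl p) u; rewrite perm_catC.
Qed.

Lemma den_step l i r : ssa (l ++ iins i ++ r) [:: i] -> instr_ok (iins i) i ->
  sched (l ++ iins i ++ r) [:: i] (l ++ iouts i ++ r) /\
  den (l ++ iins i ++ r) [:: i] (l ++ iouts i ++ r)
  = pten (pidw X l) (pten (sem i.1.1) (pidw X r)).
Proof.
move=> u ok; have s1 := sched1 ok.
have ur := ssa_subr u.
have s2 := sched_catr ur s1.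
by rewrite den_catl // den_catr // (den1 (ssa_subl ur) ok) sched_catl.
Qed.

(** Nodes with disjoint inputs act on different tensor factors, so the interchange law
    lets them be executed in either order. *)
Lemma den_swap l i j p l' : ssa l (i :: j :: p) -> instr_ok l i -> instr_ok l j ->
  uniq (iins i ++ iins j) -> sched l (i :: j :: p) l' ->
  sched l (j :: i :: p) l' /\ den l (i :: j :: p) l' = den l (j :: i :: p) l'.
Proof.
move=> u oki okj uij s.
have ul := ssa_l u.
(* Put the inputs of both nodes in front, so that both orders can be computed. *)
pose r := minus l (iins i ++ iins j).
have pl : perm_eq l (iins i ++ iins j ++ r).
  rewrite catA; apply: perm_minus => //; rewrite all_cat.
  by have /and4P[_ -> _ _] := oki; have /and4P[_ -> _ _] := okj.
have u' : ssa l (j :: i :: p).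
  by apply: ssa_perm u => //; rewrite (perm_catCA [:: i] [:: j]).
have pl' : perm_eq (iins i ++ iins j ++ r) l by rewrite perm_sym.
have u0 := ssa_perm pl (perm_refl _) u.
have u0' := ssa_perm pl (perm_refl _) u'.
have [si di] := @den_step [::] i (iins j ++ r) (@ssa_catl _ [:: i] _ u0) (instr_ok_ins oki).
have uij' := @ssa_catl _ [:: i; j] p u0.
have uji' := @ssa_catl _ [:: j; i] p u0'.
have [sj dj] := den_step (@ssa_end _ [:: i] _ [:: j] uij' si) (instr_ok_ins okj).
have [sj' dj'] := den_step (@ssa_catl _ [:: j] _ u0') (instr_ok_ins okj).
have [si' di'] :=
  @den_step [::] i (iouts j ++ r) (@ssa_end _ [:: j] _ [:: i] uji' sj') (instr_ok_ins oki).
have dij := den_cat (p := [:: i]) uij' si sj.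
have dji := den_cat (p := [:: j]) uji' sj' si'.
have sij : sched _ [:: i; j] _ := sched_cat si sj.
have sji : sched _ [:: j; i] _ := sched_cat sj' si'.
have eqd : den (iins i ++ iins j ++ r) [:: i; j] (iouts i ++ iouts j ++ r)
         = den (iins i ++ iins j ++ r) [:: j; i] (iouts i ++ iouts j ++ r).
  rewrite dij dji di dj di' dj' !pidw_nil !pten1l.
  have semt k : instr_ok l k -> wtyp X (sem k.1.1) (iins k) (iouts k).
    by case/and4P=> _ _ /eqP ed /eqP ec; rewrite /wtyp /obw ed ec.
  have tj := wtyp_ten (semt _ okj) (wtyp_id X r).
  by rewrite (pten_split (semt _ oki) tj) (pten_split' (semt _ oki) tj).
have s0 := sched_perml pl' s.
have sp : sched (iouts i ++ iouts j ++ r) p l'.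
  have /and3P[_ _ s2] := s0; have /and3P[_ _ pm] := sij.
  by apply: sched_perml s2; rewrite perm_sym.
have s0' : sched (iins i ++ iins j ++ r) (j :: i :: p) l' := sched_cat sji sp.
split; first exact: sched_perml s0'.
rewrite -(den_perml u0 pl s0) -(den_perml u0' pl s0'); congr (pcomp _ _).
by rewrite (den_cat (p := [:: i; j]) u0 sij sp) (den_cat (p := [:: j; i]) u0' sji sp) eqd.
Qed.

Lemma sched_mid l p1 j p2 l' : sched l (p1 ++ j :: p2) l' -> instr_ok (names l p1) j.
Proof.
elim: p1 l => [|i p1 IHp] l /=; first by case/andP=> ok _; rewrite /names cats0.
case/andP=> _ /IHp /and4P[us /allP sl ed ec]; apply/and4P; split=> //; apply/allP=> x /sl.
rewrite /= /names /after /= !mem_cat => /orP[/orP[->|]|->]; rewrite ?orbT //.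
by rewrite mem_filter => /andP[_ ->].
Qed.

(** A node whose inputs are available at the start depends on none of its
    predecessors and can overtake them. *)
Lemma den_bubble l p1 j p2 l' : ssa l (p1 ++ j :: p2) -> sched l (p1 ++ j :: p2) l' ->
  all (mem l) (iins j) ->
  sched l (j :: p1 ++ p2) l' /\ den l (p1 ++ j :: p2) l' = den l (j :: p1 ++ p2) l'.
Proof.
elim: p1 l => [|i p1 IHp] l u s jl //.
have /andP[oki s'] : instr_ok l i && sched (after l i) (p1 ++ j :: p2) l' by [].
have u' := ssa_after u.
have /and4P[uj _ edj ecj] := sched_mid s'.
have okj : instr_ok l j by apply/and4P.
(* By single assignment, an input of [j] that is in [l] is no output of an earlier node,
   so [i] has not consumed it. *)
have out_l x : x \in l -> x \notin flatten (map iouts (i :: p1)).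
  move=> xl; move: u; rewrite /ssa /names map_cat flatten_cat catA cat_uniq => /and3P[+ _ _].
  rewrite cat_uniq => /and3P[_ /hasPn n _]; apply/negP=> /n.
  by rewrite /= xl.
have ja x : x \in iins j -> x \in after l i.
  move=> xj; have /and4P[_ /allP /(_ x xj) /= + _ _] := sched_mid s'.
  rewrite /names mem_cat => /orP[//|xo].
  by have := out_l x (allP jl x xj); rewrite /= mem_cat xo orbT.
have dij : uniq (iins i ++ iins j).
  have /and4P[ui _ _ _] := oki.
  rewrite cat_uniq ui uj andbT; apply/hasPn=> x xj; apply/negP=> xi.
  have := ja x xj; rewrite mem_cat mem_filter xi /= orbF => xo.
  by have := out_l x (allP jl x xj); rewrite /= mem_cat xo.
have ja' : all (mem (after l i)) (iins j) by apply/allP.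
have [s2 e2] := IHp _ u' s' ja'.
have u3 : ssa l (i :: j :: p1 ++ p2).
  by apply: ssa_perm u => //; rewrite perm_cons -cat1s perm_catCA.
have s3 : sched l (i :: j :: p1 ++ p2) l' by rewrite [sched _ _ _]/= oki.
have [s4 e4] := den_swap u3 oki okj dij s3.
by split=> //; rewrite -e4 [LHS]/= e2.
Qed.

(** A diagram is a graph: the order in which the nodes are listed does not matter. *)
Lemma den_perm l p q l' : ssa l p -> sched l p l' -> sched l q l' -> perm_eq p q ->
  den l p l' = den l q l'.
Proof.
elim: q l p => [|j q IHq] l p u sp sq; first by move/perm_nilP=> ->.
move=> ppq; have jp : j \in p by rewrite (perm_mem ppq) mem_head.
have [p1 [p2 ep]] : {p1 : prog & {p2 | p = p1 ++ j :: p2}}.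
  by case/splitPr: jp => p1 p2; exists p1, p2.
move: ep => {jp} ep; rewrite {}ep in u sp ppq *.
have /andP[/and4P[_ jl _ _] sq'] := sq.
have [s1 ->] := den_bubble u sp jl.
have ppq' : perm_eq (p1 ++ p2) q.
  by rewrite -(perm_cons j) (perm_trans _ ppq) // -cat1s perm_catCA.
have u1 : ssa l (j :: p1 ++ p2).
  by apply: ssa_perm u => //; rewrite -(cat1s j p2) perm_catCA.
have /andP[_ s1'] := s1.
by rewrite /= (IHq _ _ (ssa_after u1) s1' sq' ppq').
Qed.

End Diagrams.

(** * Renaming wires *)

Section Renaming.
Variables (C : strict_symmetric_monoidal) (T : eqType) (X : T -> C).
Variables (G : eqType) (gdom gcod : G -> seq T) (sem : G -> parrow C).
Notation wire := (T * nat)%type.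
Variables (f : wire -> wire) (ws : seq wire).
Hypothesis f_color : forall x, (f x).1 = x.1.
Hypothesis f_inj : {in ws &, injective f}.

Lemma obw_map l : obw X (map f l) = obw X l.
Proof. by rewrite /obw -map_comp (eq_map f_color). Qed.

Lemma pidw_map l : pidw X (map f l) = pidw X l.
Proof. by rewrite /pidw obw_map. Qed.

Lemma rem_map x l : x \in ws -> {subset l <= ws} -> rem (f x) (map f l) = map f (rem x l).
Proof.
move=> xw; elim: l => //= y l IHl lw; rewrite (inj_in_eq f_inj (lw y (mem_head y l)) xw).
by case: eqP => //= _; rewrite IHl // => z zl; rewrite lw // inE zl orbT.
Qed.

Lemma pull_map x l : x \in ws -> {subset l <= ws} -> pull X (f x) (map f l) = pull X x l.
Proof.
move=> xw; elim: l => //= y l IHl lw; rewrite (inj_in_eq f_inj (lw y (mem_head y l)) xw).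
have lw' : {subset l <= ws} by move=> z zl; rewrite lw // inE zl orbT.
case: eqP => _; first by rewrite -(pidw_map (y :: l)).
by rewrite /swap_head /psymw !f_color rem_map // pidw_map IHl.
Qed.

Lemma permute_map l k : {subset l <= ws} -> {subset k <= ws} ->
  permute X (map f l) (map f k) = permute X l k.
Proof.
elim: k l => //= x k IHk l lw kw; have xw : x \in ws by rewrite kw ?mem_head.
rewrite pull_map // rem_map // f_color IHk //.
  by move=> z /mem_rem /lw.
by move=> z zk; rewrite kw // inE zk orbT.
Qed.

Definition rename_instr (i : instr T G) : instr T G := (i.1.1, map f (iins i), map f (iouts i)).

Definition wires (i : instr T G) := iins i ++ iouts i.

Lemma mem_map_in x s : x \in ws -> {subset s <= ws} -> (f x \in map f s) = (x \in s).
Proof.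
move=> xw sw; apply/mapP/idP => [[y ys /f_inj ->] //|xs]; last by exists x.
exact: sw.
Qed.

Lemma minus_map l s : {subset l <= ws} -> {subset s <= ws} ->
  minus (map f l) (map f s) = map f (minus l s).
Proof.
move=> lw sw; rewrite /minus filter_map; congr map; apply: eq_in_filter => x xl /=.
by rewrite mem_map_in // lw.
Qed.

Definition supp (l : seq wire) (p : prog T G) (l' : seq wire) :=
  l ++ flatten (map wires p) ++ l'.

Section Step.
Variables (l : seq wire) (i : instr T G) (p : prog T G) (l' : seq wire).
Hypothesis supp_ws : {subset supp l (i :: p) l' <= ws}.

Lemma supp_l : {subset l <= ws}.
Proof. by move=> x xl; rewrite supp_ws // mem_cat xl. Qed.

Lemma supp_ins : {subset iins i <= ws}.
Proof. by move=> x xl; rewrite supp_ws // /supp /= !mem_cat xl !orbT. Qed.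

Lemma supp_after : {subset supp (after l i) p l' <= ws}.
Proof.
move=> x; rewrite /supp /after !mem_cat mem_filter => xs; apply: supp_ws.
rewrite /supp /= !mem_cat; case/orP: xs => [/orP[->|/andP[_ ->]]|/orP[->|->]];
  by rewrite ?orbT.
Qed.

Lemma minus_rename : minus (map f l) (map f (iins i)) = map f (minus l (iins i)).
Proof. by apply: minus_map; [apply: supp_l | apply: supp_ins]. Qed.

Lemma after_rename : after (map f l) (rename_instr i) = map f (after l i).
Proof. by rewrite /after /= minus_rename map_cat. Qed.

End Step.

(** Only the incidence of wires and nodes counts, not the names. *)
Lemma den_map l p l' : {subset supp l p l' <= ws} ->
  den X sem (map f l) (map rename_instr p) (map f l') = den X sem l p l'.
Proof.
elim: p l => [|i p IHp] l sw /=.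
  by apply: permute_map => x xl; apply: sw; rewrite !mem_cat xl ?orbT.
rewrite (after_rename sw) (minus_rename sw) IHp; last exact: supp_after.
rewrite pidw_map -map_cat permute_map //; first exact: (supp_l sw).
move=> x; rewrite mem_cat mem_filter => /orP[/(supp_ins sw)|/andP[_ /(supp_l sw)]] //.
Qed.

Lemma map_fst_rename l : map fst (map f l) = map fst l.
Proof. by rewrite -map_comp (eq_map f_color). Qed.

Lemma sched_map l p l' : {subset supp l p l' <= ws} -> sched gdom gcod l p l' ->
  sched gdom gcod (map f l) (map rename_instr p) (map f l').
Proof.
elim: p l => [|i p IHp] l sw /=; first exact: perm_map.
case/andP=> /and4P[ui /allP il ed ec] sp; apply/andP; split; last first.
  by rewrite (after_rename sw) IHp //; apply: supp_after.
apply/and4P; rewrite !map_fst_rename; split=> //; last first.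
  by apply/allP=> _ /mapP [x /il xl ->]; apply: map_f.
rewrite map_inj_in_uniq // => x y /(supp_ins sw) xw /(supp_ins sw) yw.
exact: f_inj.
Qed.

End Renaming.

(** * From formulas to string diagrams *)

Section Terms.
Variables (C : strict_symmetric_monoidal) (T : eqType) (X : T -> C).
Variables (G : eqType) (gdom gcod : G -> seq T) (sem : G -> parrow C).
Hypothesis sem_typ : forall g, typ (sem g) (obt X (gdom g)) (obt X (gcod g)).
Notation wire := (T * nat)%type.

Inductive tm :=
| TGen of G
| TId of seq T
| TSym of seq T & seq T
| TCmp of tm & tm
| TTen of tm & tm.

Fixpoint tdom t := match t with
  | TGen g => gdom g | TId u => u | TSym u v => u ++ v
  | TCmp _ t => tdom t | TTen s t => tdom s ++ tdom t
  end.

Fixpoint tcod t := match t with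
  | TGen g => gcod g | TId u => u | TSym u v => v ++ u
  | TCmp s _ => tcod s | TTen s t => tcod s ++ tcod t
  end.

Fixpoint well_typed t := match t with
  | TCmp s t => [&& well_typed s, well_typed t & tdom s == tcod t]
  | TTen s t => well_typed s && well_typed t
  | _ => true
  end.

Fixpoint tsem t : parrow C := match t with
  | TGen g => sem g
  | TId u => pid (obt X u)
  | TSym u v => psym (obt X u) (obt X v)
  | TCmp s t => pcomp (tsem s) (tsem t)
  | TTen s t => pten (tsem s) (tsem t)
  end.

Definition fresh (u : seq T) (n : nat) : seq wire := zip u (iota n (size u)).

(** Every name in use is below [n], so new wires are named from [n] on.  Symmetries and
    identities yield no node; they merely rearrange the list of output wires. *)
Fixpoint compile t (l : seq wire) (n : nat) : prog T G * seq wire * nat :=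
  match t with
  | TGen g => let o := fresh (gcod g) n in ([:: (g, l, o)], o, n + size (gcod g))
  | TId _ => ([::], l, n)
  | TSym u _ => ([::], drop (size u) l ++ take (size u) l, n)
  | TCmp s t =>
      let: (p, o, m) := compile t l n in
      let: (q, o', m') := compile s o m in (p ++ q, o', m')
  | TTen s t =>
      let: (p, o, m) := compile s (take (size (tdom s)) l) n in
      let: (q, o', m') := compile t (drop (size (tdom s)) l) m in (p ++ q, o ++ o', m')
  end.

Definition outs (p : prog T G) : seq wire := flatten (map (@iouts T G) p).
Definition below n (l : seq wire) := all (fun x => x.2 < n) l.
Definition above n (l : seq wire) := all (fun x => n <= x.2) l.

Lemma fresh_range u n : below (n + size u) (fresh u n) && above n (fresh u n).
Proof.
rewrite /below /above; apply/andP; split; apply/allP => x /(map_f snd);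
  by rewrite -/(unzip2 _) unzip2_zip ?size_iota // mem_iota => /andP[].
Qed.

Lemma fresh_color u n : map fst (fresh u n) = u.
Proof. by rewrite -/(unzip1 _) unzip1_zip ?size_iota. Qed.

Lemma fresh_uniq u n : uniq (fresh u n).
Proof.
by apply: (@map_uniq _ _ snd); rewrite -/(unzip2 _) unzip2_zip ?size_iota ?iota_uniq.
Qed.

Lemma below_above n l k : below n l -> above n k -> uniq l -> uniq k -> uniq (l ++ k).
Proof.
move=> /allP bl /allP ak ul uk; rewrite cat_uniq ul uk andbT; apply/hasPn=> x xk.
by apply/negP=> /bl /=; rewrite ltnNge ak.
Qed.

Lemma sched_sub l p o : sched gdom gcod l p o -> {subset o <= names l p}.
Proof.
elim: p l => [|i p IHp] l /=; first by move=> pl x; rewrite /names cats0 (perm_mem pl).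
case/andP=> _ /IHp so x /so; rewrite /names /after /= !mem_cat mem_filter.
by case/orP=> [/orP[->|/andP[_ ->]]|->]; rewrite ?orbT.
Qed.

Lemma below_leq m n l : m <= n -> below m l -> below n l.
Proof. by move=> mn /allP bl; apply/allP=> x /bl /= xm; apply: leq_trans mn. Qed.

Lemma above_leq m n l : n <= m -> above m l -> above n l.
Proof. by move=> mn /allP bl; apply/allP=> x /bl /= xm; apply: leq_trans mn _. Qed.

Lemma outs_cat p q : outs (p ++ q) = outs p ++ outs q.
Proof. by rewrite /outs map_cat flatten_cat. Qed.

Definition compile_spec t l n (r : prog T G * seq wire * nat) :=
  let: (p, o, m) := r in
  [/\ n <= m, below m (outs p) && above n (outs p), uniq (outs p), map fst o = tcod t
    & sched gdom gcod l p o /\ den X sem l p o = tsem t].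

(** For a tensor product, the two programs run one after the other, each next to the
    idle wires of the other. *)
Lemma compile_sound t l n : well_typed t -> map fst l = tdom t -> uniq l -> below n l ->
  compile_spec t l n (compile t l n).
Proof.
elim: t l n => [g|u|u v|s IHs t IHt|s IHs t IHt] l n /=.
- move=> _ ed ul bl; have ec := fresh_color (gcod g) n.
  have ok : instr_ok gdom gcod l (g, l, fresh (gcod g) n).
    by apply/and4P; split=> //; [exact/eqP | exact/eqP].
  split=> //; rewrite ?leq_addr /outs /= ?cats0 ?fresh_range ?fresh_uniq //.
  split; first by have := sched1 ok.
  apply: (den1 sem_typ _ ok); rewrite /ssa /names /= cats0.
  by apply: below_above bl _ ul (fresh_uniq _ _); case/andP: (fresh_range (gcod g) n).
- move=> _ ed ul bl; split=> //; split=> //=.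
  by rewrite permute_id /pidw /obw ed.
- move=> _ ed ul bl.
  have et : map fst (take (size u) l) = u by rewrite map_take ed take_size_cat.
  have er : map fst (drop (size u) l) = v by rewrite map_drop ed drop_size_cat.
  split=> //; first by rewrite map_cat et er.
  split=> /=; first by rewrite -{1}(cat_take_drop (size u) l) perm_catC.
  by rewrite -{1}(cat_take_drop (size u) l) permute_sym ?cat_take_drop // /obw et er.
- case/and3P=> oks okt /eqP est ed ul bl.
  case: (compile t l n) (IHt l n okt ed ul bl) => [[p o] m] [nm /andP[bp ap] up eo [sp dp]].
  have uo : ssa l p.
    by rewrite /ssa /names; apply: below_above bl ap ul up.
  have u_o : uniq o.
    by apply: (@ssa_l _ _ o [::]); apply: (ssa_end (q := [::]) _ sp); rewrite cats0.
  have bo : below m o.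
    apply/allP=> x /(sched_sub sp); rewrite /names mem_cat => /orP[/(allP (below_leq nm bl))//|].
    exact: (allP bp).
  have edo : map fst o = tdom s by rewrite eo est.
  case: (compile s o m) (IHs o m oks edo u_o bo) => [[q o'] m'] [mm /andP[bq aq] uq eo' [sq dq]].
  split=> //; first exact: leq_trans nm mm.
  + rewrite outs_cat /below /above !all_cat -!/(below _ _) -!/(above _ _).
    by rewrite (below_leq mm bp) bq ap (above_leq nm aq).
  + by rewrite outs_cat; apply: below_above bp aq up uq.
  split; first exact: sched_cat sp sq.
  rewrite (den_cat sem_typ _ sp sq) ?dp ?dq // /ssa /names -/(outs _) outs_cat catA.
  apply: below_above aq _ uq; last exact: uo.
  by rewrite /below all_cat -!/(below _ _) (below_leq nm bl).
case/andP=> oks okt ed ul bl.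
set l1 := take _ l; set l2 := drop _ l; have el : l = l1 ++ l2 by rewrite cat_take_drop.
have ed1 : map fst l1 = tdom s by rewrite map_take ed take_size_cat.
have ed2 : map fst l2 = tdom t by rewrite map_drop ed drop_size_cat.
have [ul1 ul12 ul2] : [/\ uniq l1, ~~ has (mem l1) l2 & uniq l2].
  by apply/and3P; rewrite -cat_uniq -el.
have /andP[bl1 bl2] : below n l1 && below n l2 by rewrite -all_cat -el.
case: (compile s l1 n) (IHs l1 n oks ed1 ul1 bl1) => [[p o] m] [nm /andP[bp ap] up eo [sp dp]].
have bl2' := below_leq nm bl2.
case: (compile t l2 m) (IHt l2 m okt ed2 ul2 bl2') => [[q o'] m'] [mm /andP[bq aq] uq eo' [sq dq]].
split=> //; first exact: leq_trans nm mm.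
+ rewrite outs_cat /below /above !all_cat -!/(below _ _) -!/(above _ _).
  by rewrite (below_leq mm bp) bq ap (above_leq nm aq).
+ by rewrite outs_cat; apply: below_above bp aq up uq.
+ by rewrite map_cat eo eo'.
have up12 : ssa (l1 ++ l2) p.
  by rewrite /ssa /names -el; apply: below_above bl ap ul up.
have sp12 := sched_catr up12 sp.
have upq : ssa (l1 ++ l2) (p ++ q).
  rewrite /ssa /names -/(outs _) outs_cat catA.
  apply: below_above aq _ uq; last exact: up12.
  by rewrite /below all_cat -!/(below _ _) -el (below_leq nm bl).
have uq' := ssa_end upq sp12.
have sq12 := sched_catl uq' sq.
split; first by rewrite el; apply: sched_cat sp12 sq12.
rewrite el (den_cat sem_typ upq sp12 sq12).
rewrite (den_catr sem_typ up12 sp) (den_catl sem_typ uq' sq).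
have tp := wtyp_den sem_typ (ssa_subl up12) sp.
have tq := wtyp_den sem_typ (ssa_subr uq') sq.
by rewrite (pten_split' tp tq) dp dq.
Qed.

End Terms.

(** * Rewriting string diagrams *)

Section Rewriting.
Variables (C : strict_symmetric_monoidal) (T : eqType) (X : T -> C).
Variables (G : eqType) (gdom gcod : G -> seq T) (sem : G -> parrow C).
Hypothesis sem_typ : forall g, typ (sem g) (obt X (gdom g)) (obt X (gcod g)).
Notation wire := (T * nat)%type.
Notation tm := (tm T G).

(** Names for the wires of a pattern; a wire without an entry keeps its own name. *)
Definition env := seq (wire * nat).

Fixpoint assoc (s : env) (x : wire) : option nat :=
  match s with
  | [::] => None
  | yn :: s' => if yn.1 == x then Some yn.2 else assoc s' x
  end.

Definition ren (s : env) (x : wire) : wire := (x.1, odflt x.2 (assoc s x)).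

Fixpoint bind (xs ys : seq wire) (s : env) : option env :=
  match xs, ys with
  | [::], [::] => Some s
  | x :: xs', y :: ys' =>
      if x.1 == y.1 then
        match assoc s x with
        | Some n => if n == y.2 then bind xs' ys' s else None
        | None => bind xs' ys' ((x, y.2) :: s)
        end
      else None
  | _, _ => None
  end.

(** The search for occurrences of a pattern needs no proof: [rewrite_at] checks each
    assignment that comes out of it. *)
Fixpoint match_prog (pat tgt : prog T G) (s : env) : seq env :=
  match pat with
  | [::] => [:: s]
  | i :: pat' => flatten (map (fun j : instr T G =>
      if i.1.1 == j.1.1 then
        match bind (wires i) (wires j) s with
        | Some s' => match_prog pat' (rem j tgt) s'
        | None => [::]
        end
      else [::]) tgt)
  end.

(** An input of the pattern that no node consumes, as in a pattern made of a bare wire,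
    may be any wire of the diagram. *)
Fixpoint match_free (xs pool : seq wire) (s : env) : seq env :=
  match xs with
  | [::] => [:: s]
  | x :: xs' =>
      match assoc s x with
      | Some _ => match_free xs' pool s
      | None => flatten (map (fun y : wire =>
          if x.1 == y.1 then match_free xs' pool ((x, y.2) :: s) else [::]) pool)
      end
  end.

Definition inj_on (f : wire -> wire) (ws : seq wire) := uniq (map f (undup ws)).

Lemma inj_onP f ws : inj_on f ws -> {in ws &, injective f}.
Proof.
rewrite /inj_on => u x y; rewrite -(mem_undup ws x) -(mem_undup ws y) => xw yw exy.
apply/eqP; rewrite -(nth_index x xw) -(nth_index x yw) nth_uniq ?undup_uniq ?index_mem //.
by rewrite -(nth_uniq (f x) _ _ u) ?size_map ?index_mem // !(nth_map x) ?index_mem //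
   !nth_index // exy.
Qed.

Record diagram := Diagram { dins : seq wire; body : prog T G; douts : seq wire }.

Definition dwf D := ssa (dins D) (body D) && sched gdom gcod (dins D) (body D) (douts D).
Definition dsem D := den X sem (dins D) (body D) (douts D).

Definition diagram_of (t : tm) : diagram :=
  let l := fresh (tdom gdom t) 0 in
  let: (p, o, _) := compile gdom gcod t l (size l) in Diagram l p o.

Lemma diagram_ofP t : well_typed gdom gcod t ->
  dwf (diagram_of t) /\ dsem (diagram_of t) = tsem X sem t.
Proof.
move=> ok; set l := fresh (tdom gdom t) 0.
have el : map fst l = tdom gdom t := fresh_color _ _.
have bl : below (size l) l.
  have /andP[] := fresh_range (tdom gdom t) 0.
  by rewrite add0n -/l -(size_map fst l) el.
have := compile_sound sem_typ ok el (fresh_uniq _ _) bl.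
rewrite /diagram_of -/l; case: (compile _ _ _ _ _) => [[p o] m] /= [_ /andP[_ ap] up _ [sp dp]].
rewrite /dwf /dsem /= sp andbT; split=> //.
by rewrite /ssa /names; apply: below_above bl ap (fresh_uniq _ _) up.
Qed.

(** The nodes on which the wires [l] depend can be executed before an occurrence of a
    pattern with inputs [l], and all others after it. *)
Definition ancestors (l : seq wire) (p : prog T G) : prog T G * prog T G :=
  let: (_, A, B) := foldr (fun (i : instr T G) st =>
    let: (need, A, B) := st in
    if has (mem need) (iouts i) then (iins i ++ need, i :: A, B) else (need, A, i :: B))
    (l, [::], [::]) p in
  (A, B).

(** Replaces an occurrence of [a] by [b].  The nodes are reordered to make those of the
    occurrence consecutive, [b] is compiled on the same inputs, and the renaming [f]
    attaches the subsequent nodes to the outputs of [b].  What makes this correct for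
    a given assignment [s] is checked by computation at the end. *)
Definition rewrite_at (a b : tm) (s : env) (D : diagram) : option diagram :=
  let la := fresh (tdom gdom a) 0 in
  let: (pa, oa, _) := compile gdom gcod a la (size la) in
  let i := map (ren s) la in
  let pa' := map (rename_instr (ren s)) pa in
  let o := map (ren s) oa in
  let: (A, B) := ancestors i (foldr (fun j p => rem j p) (body D) pa') in
  let r := minus (foldl (@after T G) (dins D) A) i in
  let n := (foldr maxn 0 (map snd (names (dins D) (body D)))).+1 in
  let: (pb, ob, _) := compile gdom gcod b i n in
  let f := ren (zip o (map snd ob)) in
  let B' := map (rename_instr f) B in
  let D' := Diagram (dins D) (A ++ pb ++ B') (map f (douts D)) in
  if [&& inj_on (ren s) (supp la pa oa),
         perm_eq (body D) (A ++ pa' ++ B),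
         sched gdom gcod (dins D) A (i ++ r),
         sched gdom gcod (o ++ r) B (douts D),
         inj_on f (supp (o ++ r) B (douts D)),
         map f (o ++ r) == ob ++ r,
         below n i &
         ssa (dins D) (body D')]
  then Some D' else None.

Lemma ren_color s x : (ren s x).1 = x.1. Proof. by []. Qed.

(** Once its nodes are consecutive, the occurrence is [a] tensored with the idle wires
    [r], and there [a] may be replaced by the equal morphism [b]. *)
Lemma rewrite_atP a b s D D' : well_typed gdom gcod a -> well_typed gdom gcod b ->
  tdom gdom a = tdom gdom b -> tsem X sem a = tsem X sem b ->
  dwf D -> rewrite_at a b s D = Some D' -> dwf D' /\ dsem D' = dsem D.
Proof.
move=> oka okb eab sab /andP[uD sD]; rewrite /rewrite_at.
set la := fresh (tdom gdom a) 0.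
have ela : map fst la = tdom gdom a := fresh_color _ _.
have bla : below (size la) la.
  have /andP[] := fresh_range (tdom gdom a) 0.
  by rewrite add0n -/la -(size_map fst la) ela.
have := compile_sound sem_typ oka ela (fresh_uniq _ _) bla.
case: (compile _ _ a _ _) => [[pa oa] m] /= [_ /andP[_ apa] upa _ [spa dpa]].
case: (ancestors _ _) => [A B].
set i := map (ren s) la; set pa' := map _ pa; set o := map (ren s) oa.
set r := minus _ i; set n := _.+1.
have eli : map fst i = tdom gdom b by rewrite map_fst_rename // ela.
have spec_b : uniq i -> below n i -> compile_spec X gdom gcod sem b i n (compile gdom gcod b i n).
  exact: (compile_sound sem_typ okb eli).
case: (compile _ _ b _ _) spec_b => [[pb ob] m'] spec_b.
set f := ren (zip o _); set B' := map _ B.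
case: ifP => // /and5P[/inj_onP inj_s pp sA sB /and4P[/inj_onP inj_f /eqP fo bi u']] [<-].
have upa' := ssa_perm (perm_refl _) pp uD.
have uir : uniq (i ++ r).
  have uA := ssa_catl upa'.
  by apply: (@ssa_l _ _ _ [::]); apply: (ssa_end (q := [::]) _ sA); rewrite cats0.
have ui : uniq i by move: uir; rewrite cat_uniq => /and3P[].
have [_ _ _ _ [spb dpb]] := spec_b ui bi.
have spa' : sched gdom gcod i pa' o := sched_map (ren_color s) inj_s (fun x h => h) spa.
have dpa' : den X sem i pa' o = tsem X sem a.
  by rewrite -dpa; exact: (den_map X sem (ren_color s) inj_s (fun x h => h)).
have uend := ssa_end upa' sA.
have upair := ssa_catl uend.
have spair := sched_catr upair spa'.
have sB' := sched_map (ren_color _) inj_f (fun x h => h) sB.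
have dB' := den_map X sem (ren_color _) inj_f (fun x h => h).
rewrite fo -/B' in sB' dB'.
have ub := ssa_end u' sA.
have ub1 := ssa_catl ub.
have spbr := sched_catr ub1 spb.
have s1 := sched_cat spair sB.
have s2 := sched_cat spbr sB'.
split; first by rewrite /dwf u' (sched_cat sA s2).
rewrite /dsem /= (den_cat sem_typ u' sA s2) (den_cat sem_typ ub spbr sB').
rewrite (den_catr sem_typ ub1 spb) dpb -sab -dpa' dB'.
rewrite (den_perm sem_typ uD sD (sched_cat sA s1) pp).
rewrite (den_cat sem_typ upa' sA s1) (den_cat sem_typ uend spair sB).
by rewrite (den_catr sem_typ upair spa').
Qed.

Record rule := Rule { lhs : tm; rhs : tm; rule_eq : tsem X sem lhs = tsem X sem rhs }.

Definition wf_rule (R : rule) :=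
  [&& well_typed gdom gcod (lhs R), well_typed gdom gcod (rhs R)
    & tdom gdom (lhs R) == tdom gdom (rhs R)].

Definition rewrites (R : rule) (D : diagram) : seq diagram :=
  let la := fresh (tdom gdom (lhs R)) 0 in
  let: (pa, _, _) := compile gdom gcod (lhs R) la (size la) in
  pmap (fun s => rewrite_at (lhs R) (rhs R) s D)
    (flatten (map (match_free la (names (dins D) (body D))) (match_prog pa (body D) [::]))).

(** Unlike [has], this stops at the first success even in a call-by-value evaluation. *)
Fixpoint some (A : Type) (f : A -> bool) (s : seq A) : bool :=
  if s is x :: s' then (if f x then true else some f s') else false.

(** A depth-first search through the sequences of rewriting steps that use the rules
    [Rs] in this order, each at an arbitrary occurrence. *)
Fixpoint reaches (Rs : seq rule) (D : diagram) (goal : diagram -> bool) : bool :=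
  if Rs is R :: Rs' then
    if wf_rule R then some (fun E => reaches Rs' E goal) (rewrites R D) else false
  else goal D.

Definition iso_by (D E : diagram) (s : env) : bool :=
  [&& map (ren s) (dins D) == dins E, map (ren s) (douts D) == douts E,
      perm_eq (map (rename_instr (ren s)) (body D)) (body E)
    & inj_on (ren s) (supp (dins D) (body D) (douts D))].

Definition iso (D E : diagram) : bool :=
  if bind (dins D ++ douts D) (dins E ++ douts E) [::] is Some s then
    has (iso_by D E) (match_prog (body D) (body E) s)
  else false.

Lemma isoP D E : dwf D -> dwf E -> iso D E -> dsem D = dsem E.
Proof.
move=> /andP[uD sD] /andP[uE sE]; rewrite /iso; case: bind => // s0 /hasP[s _].
case/and4P=> /eqP el /eqP eo pp /inj_onP inj_s.
have dD := den_map X sem (ren_color s) inj_s (fun x h => h).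
have sD' := sched_map (ren_color s) inj_s (fun x h => h) sD.
rewrite /dsem -dD el eo in sD' *; apply/esym; apply: (den_perm sem_typ) => //.
by rewrite perm_sym.
Qed.

Lemma reachesP Rs D goal : dwf D -> reaches Rs D goal ->
  exists E, [/\ dwf E, dsem E = dsem D & goal E].
Proof.
elim: Rs D => [|R Rs IHRs] D wD /=; first by move=> gD; exists D.
case: ifP => // /and3P[oka okb /eqP eab].
rewrite /rewrites; case: compile => [[pa ?] ?].
elim: (flatten _) => //= s ss IHss.
case e: rewrite_at => [E|] //=.
have [wE eE] := rewrite_atP oka okb eab (rule_eq R) wD e.
case: ifP => [/(IHRs _ wE) [F [wF eF gF]] _ | _ //].
by exists F; rewrite eF.
Qed.

Definition provable (Rs Rs' : seq rule) (s t : tm) : bool :=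
  [&& well_typed gdom gcod s, well_typed gdom gcod t &
    reaches Rs (diagram_of s) (fun D => reaches Rs' (diagram_of t) (iso D))].

Lemma provableP Rs Rs' s t : provable Rs Rs' s t -> tsem X sem s = tsem X sem t.
Proof.
case/and3P=> /diagram_ofP[ws <-] /diagram_ofP[wt <-].
case/(reachesP ws) => D [wD <-] /(reachesP wt) [E [wE <-] i].
exact: isoP.
Qed.

End Rewriting.

(** * Formulas for two weak crossed products *)

(** Both crossed products are treated at once: [false] marks the data of (φ, σ) and
    [true] those of (φ', τ).  The generator [gGau b] stands for h if [b] is [true] and
    for its inverse if [b] is [false]; [gIso b] leads from the image on the side [b]
    to the image on the other side. *)
Inductive color := cH | cB | cI of bool.

Definition color_code (c : color) : nat :=
  match c with cH => 0 | cB => 1 | cI false => 2 | cI true => 3 end.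
Lemma color_code_inj : injective color_code.
Proof. by do 2![case=> [||[]]]. Qed.
HB.instance Definition _ := Equality.copy color (inj_type color_code_inj).

Inductive gen :=
| gEtaH | gMuH | gEpsH | gDeltaH | gEtaB | gMuB
| gAct of bool | gCoc of bool | gGau of bool
| gInc of bool | gProj of bool | gIso of bool.

Definition gen_code (g : gen) : nat :=
  match g with
  | gEtaH => 0 | gMuH => 1 | gEpsH => 2 | gDeltaH => 3 | gEtaB => 4 | gMuB => 5
  | gAct b => 6 + b | gCoc b => 8 + b | gGau b => 10 + b
  | gInc b => 12 + b | gProj b => 14 + b | gIso b => 16 + b
  end.
Lemma gen_code_inj : injective gen_code.
Proof.
by do 2![case=> [||||||[]|[]|[]|[]|[]|[]]].
Qed.
HB.instance Definition _ := Equality.copy gen (inj_type gen_code_inj).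

Definition gen_dom (g : gen) : seq color :=
  match g with
  | gEtaH | gEtaB => [::]
  | gMuH | gCoc _ => [:: cH; cH]
  | gEpsH | gDeltaH | gGau _ => [:: cH]
  | gMuB => [:: cB; cB]
  | gAct _ => [:: cH; cB]
  | gInc b | gIso b => [:: cI b]
  | gProj _ => [:: cB; cH]
  end.

Definition gen_cod (g : gen) : seq color :=
  match g with
  | gEpsH => [::]
  | gEtaH | gMuH => [:: cH]
  | gDeltaH => [:: cH; cH]
  | gEtaB | gMuB | gAct _ | gCoc _ | gGau _ => [:: cB]
  | gInc _ => [:: cB; cH]
  | gProj b => [:: cI b]
  | gIso b => [:: cI (~~ b)]
  end.

Notation term := (tm color gen).
Declare Scope tm_scope.
Delimit Scope tm_scope with tm.
Bind Scope tm_scope with tm.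
Notation "s ∘ t" := (TCmp s%tm t%tm) : tm_scope.
Notation "s ⊗ t" := (TTen s%tm t%tm) : tm_scope.
Definition gen_term (x : gen) : term := TGen color x.
Coercion gen_term : gen >-> tm.

Definition idH : term := TId gen [:: cH].
Definition idB : term := TId gen [:: cB].
Definition symHH : term := TSym gen [:: cH] [:: cH].
Definition symHB : term := TSym gen [:: cH] [:: cB].

Definition u1t b : term := gAct b ∘ (idH ⊗ gEtaB).
Definition Pt b : term := (gAct b ⊗ idH) ∘ (idH ⊗ symHB) ∘ (gDeltaH ⊗ idB).
Definition deltaHH : term := (idH ⊗ symHH ⊗ idH) ∘ (gDeltaH ⊗ gDeltaH).
Definition Ft b : term := (gCoc b ⊗ gMuH) ∘ deltaHH.
Definition nablat b : term := (gMuB ⊗ idH) ∘ (idB ⊗ Pt b) ∘ (idB ⊗ idH ⊗ gEtaB).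
Definition mut b : term := (gMuB ⊗ idH) ∘ (gMuB ⊗ Ft b) ∘ (idB ⊗ Pt b ⊗ idH).
Definition nut b : term := nablat b ∘ (gEtaB ⊗ gEtaH).
Definition Tt b : term := (gGau b ⊗ idH) ∘ gDeltaH.
(** The left B-linear, right H-colinear extension b ⊗ x ↦ b g(x₁) ⊗ x₂ of g : H → B. *)
Definition Thetat b : term := (gMuB ⊗ idH) ∘ (idB ⊗ Tt b).
Definition convH (s t : term) : term := gMuB ∘ (s ⊗ t) ∘ gDeltaH.

(** * Linear and colinear endomorphisms of B ⊗ H *)

Section LinearColinear.
Variables (C : strict_symmetric_monoidal) (H B : C) (wH : WeakHopf H) (aB : Algebra B).

Definition extension (f : H ~> B) : B ⊗ H ~> B ⊗ H :=
  (mu B ⊗ Id H) ∘ (Id B ⊗ ((f ⊗ Id H) ∘ delta H)).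

(** Inverse to [extension] on the left B-linear and right H-colinear morphisms. *)
Definition component (u : B ⊗ H ~> B ⊗ H) : H ~> B :=
  retype ((Id B ⊗ epsilon H) ∘ u ∘ (eta B ⊗ Id H)).

Definition between_images (q q' u : B ⊗ H ~> B ⊗ H) (S : splitting q) (T : splitting q') :
    image S ~> image T :=
  proj T ∘ u ∘ inc S.

Definition between_tensors (q q' : B ⊗ H ~> B ⊗ H) (S : splitting q) (T : splitting q')
    (v : image S ~> image T) : B ⊗ H ~> B ⊗ H :=
  inc T ∘ v ∘ proj S.

End LinearColinear.

(** * The calculus of two weak crossed products *)

Section Calculus.
Variables (C : strict_symmetric_monoidal) (H B : C) (wH : WeakHopf H) (aB : Algebra B).
Variables (phi : bool -> (H ⊗ B ~> B)) (sigma : bool -> (H ⊗ H ~> B)) (g : bool -> (H ~> B)).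
Variables (S : forall b, splitting (nabla (phi b))).
Variables (w : forall b, image (S b) ~> image (S (~~ b))).

Definition obj (c : color) : C :=
  match c with cH => H | cB => B | cI b => image (S b) end.

Definition sem (x : gen) : parrow C :=
  match x with
  | gEtaH => lift (eta H) | gMuH => lift (mu H)
  | gEpsH => lift (epsilon H) | gDeltaH => lift (delta H)
  | gEtaB => lift (eta B) | gMuB => lift (mu B)
  | gAct b => lift (phi b) | gCoc b => lift (sigma b) | gGau b => lift (g b)
  | gInc b => lift (inc (S b)) | gProj b => lift (proj (S b)) | gIso b => lift (w b)
  end.

Lemma sem_typ x : typ (sem x) (obt obj (gen_dom x)) (obt obj (gen_cod x)).
Proof. by case: x => [||||||b|b|b|b|b|b]; rewrite /= ?ten_unit_r; apply: typ_lift. Qed.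

Notation "s ≈ t" := (tsem obj sem s%tm = tsem obj sem t%tm) (at level 70).

(** Equations between morphisms are read as equations between formulas, and back.
    The words of a formula end in the unit object, whence [ten_unit_r]. *)
Ltac from_hom e :=
  move: e => /(congr1 (@lift C _ _));
  rewrite ?(lift_scomp, lift_retype, lift_ten) => e;
  rewrite /= ?ten_unit_r; exact: e.
Ltac from_equiv e :=
  move: e => /lift_equiv;
  rewrite ?(lift_scomp, lift_retype, lift_ten) => e;
  rewrite /= ?ten_unit_r; exact: e.

Notation rules := (seq (rule obj sem)).
Definition fwd s t (e : s ≈ t) : rule obj sem := Rule e.
Definition bwd s t (e : s ≈ t) : rule obj sem := Rule (esym e).

(** [diagram Rs] rewrites the string diagram of the left side with the rules [Rs], in
    this order, until it becomes the diagram of the right side; [diagram Rs and Rs']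
    rewrites the right side as well.  Generators can be compared only once the
    boolean that marks the side is known, hence the case analysis. *)
Ltac diagrams Rs Rs' :=
  apply: (@provableP _ _ obj _ gen_dom gen_cod sem sem_typ (Rs : rules) (Rs' : rules));
  repeat match goal with b : bool |- _ => case: b end;
  vm_compute; reflexivity.
Tactic Notation "diagram" constr(Rs) := diagrams Rs (Nil (rule obj sem)).
Tactic Notation "diagram" constr(Rs) "and" constr(Rs') := diagrams Rs Rs'.

Ltac to_hom e :=
  apply: lift_inj; rewrite ?(lift_scomp, lift_retype, lift_ten);
  let x := fresh in have x := e; rewrite /= ?ten_unit_r in x; exact: x.

Lemma mulB_assoc : (gMuB ∘ (gMuB ⊗ idB)) ≈ (gMuB ∘ (idB ⊗ gMuB)).
Proof. have e := @mu_assoc _ _ aB. from_equiv e. Qed.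

Lemma mulB_1l : (gMuB ∘ (gEtaB ⊗ idB)) ≈ idB.
Proof. have e := @mu_unit_l _ _ aB. from_equiv e. Qed.

Lemma mulB_1r : (gMuB ∘ (idB ⊗ gEtaB)) ≈ idB.
Proof. have e := @mu_unit_r _ _ aB. from_equiv e. Qed.

Lemma mulH_1r : (gMuH ∘ (idH ⊗ gEtaH)) ≈ idH.
Proof. have e := @mu_unit_r _ _ (@wh_algebra C H wH). from_equiv e. Qed.

Lemma mulH_assoc : (gMuH ∘ (gMuH ⊗ idH)) ≈ (gMuH ∘ (idH ⊗ gMuH)).
Proof. have e := @mu_assoc _ _ (@wh_algebra C H wH). from_equiv e. Qed.

Lemma coassoc : ((gDeltaH ⊗ idH) ∘ gDeltaH) ≈ ((idH ⊗ gDeltaH) ∘ gDeltaH).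
Proof. have e := @delta_coassoc _ _ (@wh_coalgebra C H wH). from_equiv e. Qed.

Lemma counit_l : ((gEpsH ⊗ idH) ∘ gDeltaH) ≈ idH.
Proof. have e := @delta_counit_l _ _ (@wh_coalgebra C H wH). from_equiv e. Qed.

Lemma counit_r : ((idH ⊗ gEpsH) ∘ gDeltaH) ≈ idH.
Proof. have e := @delta_counit_r _ _ (@wh_coalgebra C H wH). from_equiv e. Qed.

Lemma delta_mul : (gDeltaH ∘ gMuH) ≈ ((gMuH ⊗ gMuH) ∘ deltaHH).
Proof. have e := @wh_a1 _ _ wH; rewrite /delta_ten in e. from_hom e. Qed.

Lemma delta2_one : ((gDeltaH ⊗ idH) ∘ gDeltaH ∘ gEtaH)
  ≈ ((idH ⊗ gMuH ⊗ idH) ∘ ((gDeltaH ∘ gEtaH) ⊗ (gDeltaH ∘ gEtaH))).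
Proof. have e := @wh_a3 _ _ wH. from_equiv e. Qed.

Lemma delta2_one_op : ((gDeltaH ⊗ idH) ∘ gDeltaH ∘ gEtaH)
  ≈ ((idH ⊗ (gMuH ∘ symHH) ⊗ idH) ∘ ((gDeltaH ∘ gEtaH) ⊗ (gDeltaH ∘ gEtaH))).
Proof. have e := @wh_a3' _ _ wH. from_equiv e. Qed.

(** * Weak module algebras *)

Section Module.
Hypothesis wmod : forall b, weak_module_algebra (phi b).

Lemma act_mul b : (gAct b ∘ (idH ⊗ gMuB))
  ≈ (gMuB ∘ (gAct b ⊗ gAct b) ∘ (idH ⊗ symHB ⊗ idB) ∘ (gDeltaH ⊗ idB ⊗ idB)).
Proof. have e := wma_measuring (wmod b). from_equiv e. Qed.

Lemma one_act b : (gAct b ∘ (gEtaH ⊗ idB)) ≈ idB.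
Proof. have e := wma_unit (wmod b). from_equiv e. Qed.

Lemma u1_mul b : (u1t b ∘ gMuH) ≈ (gAct b ∘ (idH ⊗ u1t b)).
Proof. have e := wma_u1 (wmod b); rewrite /u1 in e. from_hom e. Qed.

(** (x₁.1)(x₂.b) = x.(1b). *)
Lemma u1_act b : (gMuB ∘ (u1t b ⊗ gAct b) ∘ (gDeltaH ⊗ idB)) ≈ gAct b.
Proof. diagram [:: bwd (act_mul b); fwd mulB_1l]. Qed.

(** (x₁.b)(x₂.1) = x.(b1). *)
Lemma act_u1 b : (gMuB ∘ (idB ⊗ u1t b) ∘ Pt b) ≈ gAct b.
Proof. diagram [:: bwd (act_mul b); fwd mulB_1r]. Qed.

Lemma meas_P b : (Pt b ∘ (idH ⊗ gMuB)) ≈ ((gMuB ⊗ idH) ∘ (idB ⊗ Pt b) ∘ (Pt b ⊗ idB)).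
Proof. diagram [:: fwd (act_mul b); fwd coassoc]. Qed.

(** The axiom for δ²(1) is 1₁ ⊗ 1₂ ⊗ 1₃ = 1₁ ⊗ 1₂1'₁ ⊗ 1'₂, with 1' a copy of 1.  Hence
    (1₁.b) ⊗ 1₂ = (1₁.b)(1₂.1) ⊗ 1₃ = (1₁.b)(1₂.u₁(1'₁)) ⊗ 1'₂ = 1.(b u₁(1'₁)) ⊗ 1'₂. *)
Lemma act_unit b : (Pt b ∘ (gEtaH ⊗ idB)) ≈
  ((gMuB ⊗ idH) ∘ (idB ⊗ ((u1t b ⊗ idH) ∘ gDeltaH ∘ gEtaH))).
Proof.
diagram [:: bwd (act_u1 b); fwd delta2_one; fwd (u1_mul b); bwd (act_mul b);
    fwd (one_act b)].
Qed.

Lemma nabla_lin b : (nablat b ∘ (gMuB ⊗ idH)) ≈ ((gMuB ⊗ idH) ∘ (idB ⊗ nablat b)).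
Proof. diagram [:: fwd mulB_assoc]. Qed.

Lemma nabla_colin b : ((idB ⊗ gDeltaH) ∘ nablat b) ≈ ((nablat b ⊗ idH) ∘ (idB ⊗ gDeltaH)).
Proof. diagram [:: bwd coassoc]. Qed.

Lemma nabla_idem b : (nablat b ∘ nablat b) ≈ nablat b.
Proof. diagram [:: fwd mulB_assoc; bwd coassoc; fwd (u1_act b)]. Qed.

(** * Cocycles and crossed products *)

Section Cocycle.
Hypothesis conv_u2 : forall b, conv (delta_ten H H) (sigma b) (u2 (phi b)) = sigma b.
Hypothesis tw : forall b, twisted (phi b) (sigma b).
Hypothesis nm : forall b, normal (phi b) (sigma b).

Lemma coc_u2 b : (gMuB ∘ (gCoc b ⊗ (u1t b ∘ gMuH)) ∘ deltaHH) ≈ gCoc b.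
Proof. have e := conv_u2 b; rewrite /conv /delta_ten /u2 /u1 in e. from_hom e. Qed.

Lemma coc_twisted b : (gMuB ∘ (idB ⊗ gCoc b) ∘ (Pt b ⊗ idH) ∘ (idH ⊗ Pt b))
  ≈ (gMuB ∘ (idB ⊗ gAct b) ∘ (Ft b ⊗ idB)).
Proof. have e := tw b; rewrite /twisted /P /F /delta_ten in e. from_equiv e. Qed.

Lemma coc_one b : (gCoc b ∘ (idH ⊗ gEtaH)) ≈ u1t b.
Proof. have e := proj2 (nm b); rewrite /u1 in e. from_equiv e. Qed.

(** The twisted condition at the unit of B reads
    (x₁.(y₁.1)) σ(x₂ ⊗ y₂) = σ(x₁ ⊗ y₁) u₁(x₂y₂). *)
Lemma u2_coc b : (gMuB ∘ ((u1t b ∘ gMuH) ⊗ gCoc b) ∘ deltaHH) ≈ gCoc b.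
Proof. diagram [:: fwd (u1_mul b); fwd (coc_twisted b); fwd (coc_u2 b)]. Qed.

(** Write σ as u₂ ∗ σ and use u₁(x₁) u₁(x₂y) = (x₁.1)(x₂.u₁(y)) = u₁(xy). *)
Lemma u1_coc b : (gMuB ∘ (u1t b ⊗ gCoc b) ∘ (gDeltaH ⊗ idH)) ≈ gCoc b.
Proof.
diagram [:: bwd (u2_coc b); bwd mulB_assoc; bwd coassoc; fwd (u1_mul b); fwd (u1_act b);
    bwd (u1_mul b); fwd (u2_coc b)].
Qed.

(** Since σ = σ ∗ u₂, the left side is σ(x₁ ⊗ 1₁) u₁(x₂1₂) ⊗ x₃1₃.  The second axiom
    for δ²(1) turns 1₁ ⊗ 1₂ ⊗ 1₃ into 1₁ ⊗ 1'₁1₂ ⊗ 1'₂, and δ(x)δ(1') = δ(x); there remains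
    σ(x₁ ⊗ 1₁) u₁(x₂1₂) ⊗ x₃ = σ(x₁ ⊗ 1) ⊗ x₂, which is u₁(x₁) ⊗ x₂ by normality. *)
Lemma F_eta b : (Ft b ∘ (idH ⊗ gEtaH)) ≈ ((u1t b ⊗ idH) ∘ gDeltaH).
Proof.
diagram [:: bwd (coc_u2 b); fwd delta2_one_op; bwd mulH_assoc; fwd coassoc;
    bwd delta_mul; fwd mulH_1r; bwd coassoc; fwd (coc_u2 b); fwd (coc_one b)].
Qed.

(** The counit of H is not multiplicative; but σ = σ ∗ u₂ produces the coproduct
    of x₂y₂, which absorbs the counit. *)
Lemma F_eps b : ((idB ⊗ gEpsH) ∘ Ft b) ≈ gCoc b.
Proof.
diagram [:: bwd (coc_u2 b); fwd coassoc; fwd coassoc; bwd delta_mul; fwd counit_r;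
    fwd (coc_u2 b)].
Qed.

(** The product of the crossed product lives on the image of ∇: here and in the two
    lemmas that follow, ∇ is absorbed in each variable and in the result. *)
Lemma mu_nablaL b : (mut b ∘ (nablat b ⊗ idB ⊗ idH)) ≈ mut b.
Proof. diagram [:: fwd mulB_assoc; bwd coassoc; fwd (u1_act b)]. Qed.

Lemma mu_nablaR b : (mut b ∘ (idB ⊗ idH ⊗ nablat b)) ≈ mut b.
Proof.
diagram [:: fwd (act_mul b); bwd (u1_mul b); fwd mulB_assoc; fwd mulB_assoc;
    fwd coassoc; bwd coassoc; bwd coassoc; fwd (u2_coc b); bwd mulB_assoc].
Qed.

Lemma nabla_mu b : (nablat b ∘ mut b) ≈ mut b.
Proof.
diagram [:: fwd mulB_assoc; fwd delta_mul; bwd coassoc; bwd coassoc; fwd (coc_u2 b)].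
Qed.

Lemma inc_projE b : (gInc b ∘ gProj b) ≈ nablat b.
Proof. have e := esym (inc_proj (S b)); rewrite /nabla /P in e. from_hom e. Qed.

Lemma proj_incE b : (gProj b ∘ gInc b) ≈ TId gen [:: cI b].
Proof. have e := proj_inc (S b). from_hom e. Qed.

Definition prodt b : term := gProj b ∘ mut b ∘ (gInc b ⊗ gInc b).
Definition unitt b : term := gProj b ∘ nut b.
Definition actt b : term := gProj b ∘ (gMuB ⊗ idH) ∘ (idB ⊗ gInc b).
Definition coactt b : term := (gProj b ⊗ idH) ∘ (idB ⊗ gDeltaH) ∘ gInc b.
Definition idI b : term := TId gen [:: cI b].

(** * From a gauge transformation to an equivalence *)

Section FromGauge.
Hypothesis g_conv : forall b, conv (delta H) (g b) (g (~~ b)) = u1 (phi b).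
Hypothesis g_triple : forall b, conv (delta H) (conv (delta H) (g b) (g (~~ b))) (g b) = g b.
Hypothesis g_unit : g true ∘ eta H = eta B.
Hypothesis g_act : mu B ∘ (Id B ⊗ g true) ∘ P (phi true)
      = mu B ∘ (g true ⊗ phi false) ∘ (delta H ⊗ Id B).
Hypothesis g_coc : mu B ∘ (Id B ⊗ g true) ∘ F (sigma true)
      = mu B ∘ (mu B ⊗ sigma false) ∘ (Id B ⊗ P (phi false) ⊗ Id H)
        ∘ (((g true ⊗ Id H) ∘ delta H) ⊗ ((g true ⊗ Id H) ∘ delta H)).
Hypothesis w_def : forall b, w b = between_images (extension wH aB (g b)) (S b) (S (~~ b)).

Lemma gau_conv b : convH (gGau b) (gGau (~~ b)) ≈ u1t b.
Proof. have e := g_conv b; rewrite /conv /u1 in e. from_hom e. Qed.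

Lemma gau_triple b : convH (convH (gGau b) (gGau (~~ b))) (gGau b) ≈ gGau b.
Proof. have e := g_triple b; rewrite /conv in e. from_hom e. Qed.

Lemma gau_one : (gGau true ∘ gEtaH) ≈ gEtaB.
Proof. have e := g_unit. from_hom e. Qed.

Lemma gau_act : (gMuB ∘ (idB ⊗ gGau true) ∘ Pt true)
   ≈ (gMuB ∘ (gGau true ⊗ gAct false) ∘ (gDeltaH ⊗ idB)).
Proof. have e := g_act; rewrite /P in e. from_hom e. Qed.

Lemma gau_coc : (gMuB ∘ (idB ⊗ gGau true) ∘ Ft true)
   ≈ (gMuB ∘ (gMuB ⊗ gCoc false) ∘ (idB ⊗ Pt false ⊗ idH) ∘ (Tt true ⊗ Tt true)).
Proof. have e := g_coc; rewrite /P /F /delta_ten in e. from_hom e. Qed.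

Lemma iso_def b : gIso b ≈ (gProj (~~ b) ∘ Thetat b ∘ gInc b).
Proof. have e := w_def b; rewrite /between_images /extension in e. from_hom e. Qed.

Lemma gau_u1l b : convH (u1t b) (gGau b) ≈ gGau b.
Proof. diagram [:: bwd (gau_conv b); fwd (gau_triple b)]. Qed.

Lemma gau_u1r b : convH (gGau b) (u1t (~~ b)) ≈ gGau b.
Proof.
diagram [:: bwd (gau_conv (~~ b)); bwd mulB_assoc; bwd coassoc; fwd (gau_triple b)].
Qed.

(** The relation between the two actions, extended by coassociativity so as to keep
    the last leg of δ²(x). *)
Lemma gau_act_colinear : ((gMuB ⊗ idH) ∘ (idB ⊗ Tt true) ∘ Pt true)
   ≈ ((gMuB ⊗ idH) ∘ (idB ⊗ Pt false) ∘ (Tt true ⊗ idB)).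
Proof. diagram [:: bwd coassoc; fwd gau_act; fwd coassoc]. Qed.

(** The relation between the two cocycles, extended in the same way. *)
Lemma gau_coc_colinear : ((gMuB ⊗ idH) ∘ (idB ⊗ Tt true) ∘ Ft true)
   ≈ ((gMuB ⊗ idH) ∘ (gMuB ⊗ Ft false) ∘ (idB ⊗ Pt false ⊗ idH) ∘ (Tt true ⊗ Tt true)).
Proof.
diagram [:: fwd delta_mul; bwd coassoc; bwd coassoc; fwd gau_coc; fwd coassoc;
    fwd coassoc; fwd coassoc].
Qed.

(** With [gau_coc_colinear], [gau_act_colinear] and [meas_P] in turn, and x.'c for φ',
    b(x₁.'c) τ(x₂ ⊗ y₁) h(x₃y₂) ⊗ x₄y₃
    = b(x₁.'c) h(x₂) (x₃.h(y₁)) σ(x₄ ⊗ y₂) ⊗ x₅y₃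
    = b h(x₁) (x₂.c) (x₃.h(y₁)) σ(x₄ ⊗ y₂) ⊗ x₅y₃
    = b h(x₁) (x₂.(c h(y₁))) σ(x₃ ⊗ y₂) ⊗ x₄y₃. *)
Lemma Theta_mu : (Thetat true ∘ mut true) ≈ (mut false ∘ (Thetat true ⊗ Thetat true)).
Proof.
diagram [:: fwd mulB_assoc; fwd mulB_assoc; fwd gau_coc_colinear; bwd mulB_assoc;
    bwd mulB_assoc; fwd gau_act_colinear; fwd mulB_assoc; fwd mulB_assoc;
    fwd mulB_assoc] and [:: fwd (meas_P false); fwd mulB_assoc; fwd mulB_assoc;
    fwd mulB_assoc].
Qed.

(** h(1₁)(1₂.b) = (1₁.'b) h(1₂) = b u₁'(1₁) h(1₂) = b h(1), where [act_unit] gives the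
    middle step. *)
Lemma gau_act_one : (gMuB ∘ (gGau true ⊗ gAct false) ∘ ((gDeltaH ∘ gEtaH) ⊗ idB)) ≈ idB.
Proof.
diagram [:: bwd gau_act; fwd (act_unit true); fwd mulB_assoc; fwd (gau_u1l true);
    fwd gau_one; fwd mulB_1r].
Qed.

(** From h(1) = 1 alone: with the axiom for δ²(1) and [gau_act_one],
    h(1₁) ⊗ 1₂ = h(1₁) u₁(1₂) ⊗ 1₃ = h(1₁)(1₂.u₁(1'₁)) ⊗ 1'₂ = u₁(1'₁) ⊗ 1'₂. *)
Lemma gau_delta_one : (Tt true ∘ gEtaH) ≈ ((u1t false ⊗ idH) ∘ gDeltaH ∘ gEtaH).
Proof.
diagram [:: bwd (gau_u1r true); fwd delta2_one; fwd (u1_mul false); fwd gau_act_one].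
Qed.

Lemma Theta_nu : (Thetat true ∘ nut true) ≈ nut false.
Proof. diagram [:: fwd mulB_assoc; bwd coassoc; fwd (gau_u1l true); fwd gau_delta_one]. Qed.

Lemma Theta_inv b : (Thetat (~~ b) ∘ Thetat b) ≈ nablat b.
Proof. diagram [:: fwd mulB_assoc; bwd coassoc; fwd (gau_conv b)]. Qed.

Lemma nabla_Theta b : (nablat (~~ b) ∘ Thetat b) ≈ Thetat b.
Proof. diagram [:: fwd mulB_assoc; bwd coassoc; fwd (gau_u1r b)]. Qed.

Lemma Theta_nabla b : (Thetat b ∘ nablat b) ≈ Thetat b.
Proof. diagram [:: fwd mulB_assoc; bwd coassoc; fwd (gau_u1l b)]. Qed.

Lemma Theta_lin b : (Thetat b ∘ (gMuB ⊗ idH)) ≈ ((gMuB ⊗ idH) ∘ (idB ⊗ Thetat b)).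
Proof. diagram [:: fwd mulB_assoc]. Qed.

Lemma Theta_colin b : ((idB ⊗ gDeltaH) ∘ Thetat b) ≈ ((Thetat b ⊗ idH) ∘ (idB ⊗ gDeltaH)).
Proof. diagram [:: bwd coassoc]. Qed.

Lemma iso_inv b : (gIso (~~ b) ∘ gIso b) ≈ idI b.
Proof.
diagram [:: fwd (iso_def b); fwd (iso_def (~~ b)); fwd (inc_projE (~~ b));
    fwd (nabla_Theta b); fwd (Theta_inv b); bwd (inc_projE b); fwd (proj_incE b);
    fwd (proj_incE b)].
Qed.

Lemma iso_lin b : (gIso b ∘ actt b) ≈ (actt (~~ b) ∘ (idB ⊗ gIso b)).
Proof.
diagram [:: fwd (iso_def b); fwd (inc_projE b); fwd (Theta_nabla b); fwd (Theta_lin b)]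
  and [:: fwd (iso_def b); fwd (inc_projE (~~ b)); fwd (nabla_Theta b)].
Qed.

Lemma iso_colin b : ((gIso b ⊗ idH) ∘ coactt b) ≈ (coactt (~~ b) ∘ gIso b).
Proof.
diagram [:: fwd (iso_def b); fwd (inc_projE b); fwd (Theta_nabla b);
    bwd (Theta_colin b)] and [:: fwd (iso_def b); fwd (inc_projE (~~ b));
    fwd (nabla_Theta b)].
Qed.

Lemma iso_unit_true : (gIso true ∘ unitt true) ≈ unitt false.
Proof.
diagram [:: fwd (iso_def true); fwd (inc_projE true); fwd (Theta_nabla true);
    fwd Theta_nu].
Qed.

Lemma iso_mu_true : (gIso true ∘ prodt true) ≈ (prodt false ∘ (gIso true ⊗ gIso true)).
Proof.
diagram [:: fwd (iso_def true); fwd (inc_projE true); fwd (Theta_nabla true);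
    fwd Theta_mu] and [:: fwd (iso_def true); fwd (iso_def true); fwd (inc_projE false);
    fwd (inc_projE false); fwd (nabla_Theta true); fwd (nabla_Theta true)].
Qed.

(** The gauge equations speak of h, so unit and product are first preserved by the
    isomorphism that comes from h; the other isomorphism is its inverse. *)
Lemma iso_unit : (gIso false ∘ unitt false) ≈ unitt true.
Proof. diagram [:: bwd iso_unit_true; fwd (iso_inv true)]. Qed.

Lemma iso_mu : (gIso false ∘ prodt false) ≈ (prodt true ∘ (gIso false ⊗ gIso false)).
Proof.
symmetry; diagram [:: bwd (iso_inv true); fwd iso_mu_true; fwd (iso_inv false);
    fwd (iso_inv false)].
Qed.

Lemma equivalent_of_gauge : wcp_equivalent (sigma false) (sigma true) (S false) (S true).
Proof.
exists (w false), (w true); split; [split | split; [split | split]].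
- to_hom (iso_inv false).
- to_hom (iso_inv true).
- rewrite /wcp_product /wcp_mu /P /F /delta_ten; to_hom iso_mu.
- rewrite /wcp_unit /nu /nabla /P; to_hom iso_unit.
- rewrite /wcp_action; to_hom (iso_lin false).
- rewrite /wcp_coaction; to_hom (iso_colin false).
Qed.

End FromGauge.

(** * From an equivalence to a gauge transformation *)

Section FromIso.
Hypothesis w_inv : forall b, w (~~ b) ∘ w b ≡ Id (image (S b)).
Hypothesis w_mu : w false ∘ wcp_product (S false) (sigma false)
  = wcp_product (S true) (sigma true) ∘ (w false ⊗ w false).
Hypothesis w_unit : w false ∘ wcp_unit (S false) = wcp_unit (S true).
Hypothesis w_lin : w false ∘ wcp_action (S false) = wcp_action (S true) ∘ (Id B ⊗ w false).
Hypothesis w_colin : (w false ⊗ Id H) ∘ wcp_coaction (S false) = wcp_coaction (S true) ∘ w false.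
Hypothesis g_def : forall b, g b = component wH aB (between_tensors (w b)).

(** The isomorphism between the images, seen as an endomorphism of B ⊗ H. *)
Definition Lt b : term := gInc (~~ b) ∘ gIso b ∘ gProj b.

Lemma w_invE b : (gIso (~~ b) ∘ gIso b) ≈ idI b.
Proof. have e := w_inv b. from_equiv e. Qed.

Lemma w_mu_falseE : (gIso false ∘ prodt false) ≈ (prodt true ∘ (gIso false ⊗ gIso false)).
Proof. have e := w_mu; rewrite /wcp_product /wcp_mu /P /F /delta_ten in e. from_hom e. Qed.

Lemma w_unit_falseE : (gIso false ∘ unitt false) ≈ unitt true.
Proof. have e := w_unit; rewrite /wcp_unit /nu /nabla /P in e. from_hom e. Qed.

Lemma w_lin_falseE : (gIso false ∘ actt false) ≈ (actt true ∘ (idB ⊗ gIso false)).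
Proof. have e := w_lin; rewrite /wcp_action in e. from_hom e. Qed.

Lemma w_colin_falseE : ((gIso false ⊗ idH) ∘ coactt false) ≈ (coactt true ∘ gIso false).
Proof. have e := w_colin; rewrite /wcp_coaction in e. from_hom e. Qed.

Lemma g_defE b : gGau b ≈ ((idB ⊗ gEpsH) ∘ Lt b ∘ (gEtaB ⊗ idH)).
Proof. have e := g_def b; rewrite /component /between_tensors in e. from_hom e. Qed.

Lemma w_mu_trueE : (gIso true ∘ prodt true) ≈ (prodt false ∘ (gIso true ⊗ gIso true)).
Proof.
symmetry; diagram [:: bwd (w_invE false); fwd w_mu_falseE; fwd (w_invE true);
    fwd (w_invE true)].
Qed.

Lemma w_unit_trueE : (gIso true ∘ unitt true) ≈ unitt false.
Proof. diagram [:: bwd w_unit_falseE; fwd (w_invE false)]. Qed.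

Lemma w_lin_trueE : (gIso true ∘ actt true) ≈ (actt false ∘ (idB ⊗ gIso true)).
Proof. symmetry; diagram [:: bwd (w_invE false); fwd w_lin_falseE; fwd (w_invE true)]. Qed.

Lemma w_colin_trueE : ((gIso true ⊗ idH) ∘ coactt true) ≈ (coactt false ∘ gIso true).
Proof.
symmetry; diagram [:: bwd (w_invE false); fwd w_colin_falseE; fwd (w_invE true)].
Qed.

Lemma w_linE b : (gIso b ∘ actt b) ≈ (actt (~~ b) ∘ (idB ⊗ gIso b)).
Proof. by case: b; [apply: w_lin_trueE | apply: w_lin_falseE]. Qed.

Lemma w_colinE b : ((gIso b ⊗ idH) ∘ coactt b) ≈ (coactt (~~ b) ∘ gIso b).
Proof. by case: b; [apply: w_colin_trueE | apply: w_colin_falseE]. Qed.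

Lemma proj_nabla b : (gProj b ∘ nablat b) ≈ gProj b.
Proof. diagram [:: bwd (inc_projE b); fwd (proj_incE b)]. Qed.

Lemma nabla_inc b : (nablat b ∘ gInc b) ≈ gInc b.
Proof. diagram [:: bwd (inc_projE b); fwd (proj_incE b)]. Qed.

(** ∇ is B-linear, so the actions on the images are restrictions of multiplication
    in the first factor of B ⊗ H; likewise for the coactions in [L_colin]. *)
Lemma L_lin b : (Lt b ∘ (gMuB ⊗ idH)) ≈ ((gMuB ⊗ idH) ∘ (idB ⊗ Lt b)).
Proof.
diagram [:: bwd (proj_nabla b); fwd (nabla_lin b); bwd (inc_projE b); fwd (w_linE b);
    fwd (inc_projE (~~ b)); fwd (nabla_lin (~~ b)); fwd (nabla_inc (~~ b))].
Qed.

Lemma L_colin b : ((idB ⊗ gDeltaH) ∘ Lt b) ≈ ((Lt b ⊗ idH) ∘ (idB ⊗ gDeltaH)).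
Proof.
diagram [:: bwd (nabla_inc (~~ b)); fwd (nabla_colin (~~ b)); bwd (inc_projE (~~ b));
    bwd (w_colinE b); fwd (inc_projE b); fwd (nabla_colin b); fwd (proj_nabla b)].
Qed.

Lemma T_L b : Tt b ≈ (Lt b ∘ (gEtaB ⊗ idH)).
Proof. diagram [:: fwd (g_defE b); bwd (L_colin b); fwd counit_l]. Qed.

(** By colinearity ([T_L]) L(1 ⊗ x) = g(x₁) ⊗ x₂, and by linearity L is determined by
    its values on 1 ⊗ H. *)
Lemma Theta_L b : Thetat b ≈ Lt b.
Proof. diagram [:: fwd (T_L b); bwd (L_lin b); fwd mulB_1r]. Qed.

Lemma Theta_inv_of_iso b : (Thetat (~~ b) ∘ Thetat b) ≈ nablat b.
Proof.
diagram [:: fwd (Theta_L b); fwd (Theta_L (~~ b)); fwd (proj_incE (~~ b));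
    fwd (w_invE b); fwd (inc_projE b)].
Qed.

Lemma Theta_nabla_of_iso b : (Thetat b ∘ nablat b) ≈ Thetat b.
Proof. diagram [:: fwd (Theta_L b); fwd (proj_nabla b); bwd (Theta_L b)]. Qed.

Lemma Theta_mu_of_iso : (Thetat true ∘ mut true) ≈ (mut false ∘ (Thetat true ⊗ Thetat true)).
Proof.
diagram [:: fwd (Theta_L true); bwd (mu_nablaR true); bwd (inc_projE true);
    bwd (mu_nablaL true); bwd (inc_projE true); fwd w_mu_trueE; fwd (inc_projE false);
    fwd (nabla_mu false); bwd (Theta_L true); bwd (Theta_L true)].
Qed.

Lemma T_eta_of_iso : (Tt true ∘ gEtaH) ≈ ((u1t false ⊗ idH) ∘ gDeltaH ∘ gEtaH).
Proof.
diagram [:: fwd (T_L true); bwd (proj_nabla true); fwd w_unit_trueE;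
    fwd (inc_projE false); fwd (nabla_idem false); fwd mulB_1l].
Qed.

Definition apply_eps (t : term) : term := (idB ⊗ gEpsH) ∘ t.

(** Equations for g are read off from equations for Θ by evaluating them at 1 ⊗ x and
    applying B ⊗ ε; this one comes from Θ⁻¹Θ = ∇. *)
Lemma conv_of_iso b : convH (gGau b) (gGau (~~ b)) ≈ u1t b.
Proof.
transitivity (tsem obj sem (apply_eps (Thetat (~~ b) ∘ Thetat b) ∘ (gEtaB ⊗ idH))).
  symmetry; diagram [:: fwd mulB_assoc; fwd mulB_1l; bwd coassoc; fwd counit_r].
diagram [:: fwd (Theta_inv_of_iso b); fwd mulB_1l; fwd counit_r].
Qed.

Lemma u1l_of_iso b : convH (u1t b) (gGau b) ≈ gGau b.
Proof.
transitivity (tsem obj sem (apply_eps (Thetat b ∘ nablat b) ∘ (gEtaB ⊗ idH))).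
  symmetry; diagram [:: fwd mulB_assoc; fwd mulB_1l; bwd coassoc; fwd counit_r].
diagram [:: fwd (Theta_nabla_of_iso b); fwd mulB_1l; fwd counit_r].
Qed.

Lemma triple_of_iso b : convH (convH (gGau b) (gGau (~~ b))) (gGau b) ≈ gGau b.
Proof. diagram [:: fwd (conv_of_iso b); fwd (u1l_of_iso b)]. Qed.

Lemma one_of_iso : (gGau true ∘ gEtaH) ≈ gEtaB.
Proof.
transitivity (tsem obj sem (apply_eps (Tt true ∘ gEtaH))).
  symmetry; diagram [:: fwd counit_r].
diagram [:: fwd T_eta_of_iso; fwd counit_r; fwd (one_act false)].
Qed.

(** Multiplicativity of Θ at (1 ⊗ x) ⊗ (b ⊗ 1).  On the right, Θ(b ⊗ 1) = ∇(b ⊗ 1),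
    and ∇ disappears in the product. *)
Lemma act_of_iso : (gMuB ∘ (idB ⊗ gGau true) ∘ Pt true)
   ≈ (gMuB ∘ (gGau true ⊗ gAct false) ∘ (gDeltaH ⊗ idB)).
Proof.
transitivity (tsem obj sem (apply_eps (Thetat true ∘ mut true) ∘ (gEtaB ⊗ idH ⊗ idB ⊗ gEtaH))).
  symmetry; diagram [:: fwd mulB_1l; fwd (F_eta true); bwd coassoc; fwd (act_u1 true);
      fwd counit_r].
diagram [:: fwd Theta_mu_of_iso; fwd T_eta_of_iso; fwd (mu_nablaR false); fwd mulB_1l;
    fwd (F_eta false); bwd coassoc; fwd mulB_assoc; fwd (act_u1 false); fwd counit_r].
Qed.

(** Multiplicativity of Θ at (1 ⊗ x) ⊗ (1 ⊗ y). *)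
Lemma coc_of_iso : (gMuB ∘ (idB ⊗ gGau true) ∘ Ft true)
   ≈ (gMuB ∘ (gMuB ⊗ gCoc false) ∘ (idB ⊗ Pt false ⊗ idH) ∘ (Tt true ⊗ Tt true)).
Proof.
transitivity (tsem obj sem (apply_eps (Thetat true ∘ mut true) ∘ (gEtaB ⊗ idH ⊗ gEtaB ⊗ idH))).
  symmetry; diagram [:: fwd mulB_1l; bwd coassoc; fwd (u1_coc true); fwd counit_r].
diagram [:: fwd Theta_mu_of_iso; fwd mulB_1l; fwd mulB_1l; fwd (F_eps false)].
Qed.

Lemma gauge_of_equivalent :
  gauge (phi false) (g true) (g false) /\
  conv (delta H) (g true) (g false) = u1 (phi true) /\
  g true ∘ eta H = eta B /\
  mu B ∘ (Id B ⊗ g true) ∘ P (phi true) = mu B ∘ (g true ⊗ phi false) ∘ (delta H ⊗ Id B) /\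
  mu B ∘ (Id B ⊗ g true) ∘ F (sigma true)
    = mu B ∘ (mu B ⊗ sigma false) ∘ (Id B ⊗ P (phi false) ⊗ Id H)
      ∘ (((g true ⊗ Id H) ∘ delta H) ⊗ ((g true ⊗ Id H) ∘ delta H)).
Proof.
split; [split; [|split]|split; [|split; [|split]]].
- rewrite /conv /u1; to_hom (conv_of_iso false).
- rewrite /conv; to_hom (triple_of_iso true).
- rewrite /conv; to_hom (triple_of_iso false).
- rewrite /conv /u1; to_hom (conv_of_iso true).
- to_hom one_of_iso.
- rewrite /P; to_hom act_of_iso.
- rewrite /P /F /delta_ten; to_hom coc_of_iso.
Qed.

End FromIso.
End Cocycle.
End Module.

End Calculus.

(** * Equivalence of weak crossed products *)

Theorem theorem3p7
  (C : strict_symmetric_monoidal) (hC : idempotents_split C)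
  (H B : C) (wH : WeakHopf H) (aB : Algebra B)
  (phi phi' : H ⊗ B ~> B)
  (hphi : weak_module_algebra phi) (hphi' : weak_module_algebra phi')
  (sigma tau : H ⊗ H ~> B)
  (hsigma : conv (delta_ten H H) sigma (u2 phi) = sigma)
  (htau : conv (delta_ten H H) tau (u2 phi') = tau)
  (sigma_twisted : twisted phi sigma) (tau_twisted : twisted phi' tau)
  (sigma_cocycle : cocycle phi sigma) (tau_cocycle : cocycle phi' tau)
  (sigma_normal : normal phi sigma) (tau_normal : normal phi' tau)
  (S : splitting (nabla phi)) (T : splitting (nabla phi')) :
  wcp_equivalent sigma tau S T
  <->
  exists h hinv : H ~> B,
    gauge phi h hinv /\
    conv (delta H) h hinv = u1 phi' /\
    h ∘ eta H = eta B /\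
    mu B ∘ (Id B ⊗ h) ∘ P phi' = mu B ∘ (h ⊗ phi) ∘ (delta H ⊗ Id B) /\
    mu B ∘ (Id B ⊗ h) ∘ F tau
      = mu B ∘ (mu B ⊗ sigma) ∘ (Id B ⊗ P phi ⊗ Id H)
        ∘ (((h ⊗ Id H) ∘ delta H) ⊗ ((h ⊗ Id H) ∘ delta H)).
Proof.
pose act b := if b then phi' else phi.
pose coc b := if b then tau else sigma.
pose spl b : splitting (nabla (act b)) :=
  if b as b' return splitting (nabla (act b')) then T else S.
have mact b : weak_module_algebra (act b) by case: b.
have ccoc b : conv (delta_ten H H) (coc b) (u2 (act b)) = coc b by case: b.
have tcoc b : twisted (act b) (coc b) by case: b.
have ncoc b : normal (act b) (coc b) by case: b.
split.
- case=> [v [v' [[vK v'K] [[v_mu v_unit] [v_lin v_colin]]]]].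
  pose w b : image (spl b) ~> image (spl (~~ b)) :=
    if b as b' return image (spl b') ~> image (spl (~~ b')) then v' else v.
  pose h b := component wH aB (between_tensors (w b)).
  exists (h true), (h false).
  apply: (@gauge_of_equivalent C H B wH aB act coc h spl w) => // b.
  by case: b => /=; rewrite ?vK ?v'K.
- case=> [h [hinv [[hh [h3 hinv3]] [hconv [h1 [hact hcoc]]]]]].
  pose g b := if b then h else hinv.
  pose w b := between_images (extension wH aB (g b)) (spl b) (spl (~~ b)).
  by apply: (@equivalent_of_gauge C H B wH aB act coc g spl w) => //; case.
Qed.
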